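(* The set of peak Young quasisymmetric Schur functions $\{\widetilde{\mathcal{S}}_\alpha : \alpha \text{ is a peak composition}\}$ forms a basis of the peak algebra $\mathsf{Peak}$.
   Context: Compositions. A composition $\alpha=(\alpha_1,\dots,\alpha_k)\vDash n$ is a sequence of positive integers with sum $n$; $\mathrm{Des}(\alpha)=\{\alpha_1,\alpha_1+\alpha_2,\dots,\alpha_1+\cdots+\alpha_{k-1}\}\subseteq [n-1]$, where $[m]=\{1,\dots,m\}$; $\mathrm{comp}_n(X)$ is the composition of $n$ with descent set $X\subseteq[n-1]$. For a set $X$ of positive integers, $\mathrm{Peak}(X)=\{i\in X: i>1,\ i-1\notin X\}$; $\mathrm{Peak}(\alpha)=\mathrm{Peak}(\mathrm{Des}(\alpha))$. A peak composition is a composition all of whose parts, except possibly the last, are greater than $1$. Functions. For $\alpha\vDash n$, $F_\alpha=\sum x_{i_1}\cdots x_{i_n}$ over positive integers $i_1\le\cdots\le i_n$ with $i_j<i_{j+1}$ whenever $j\in\mathrm{Des}(\alpha)$. For a peak composition $\alpha\vDash n$, $K_\alpha=2^{|\mathrm{Peak}(\alpha)|+1}\sum_\beta F_\beta$, sum over $\beta\vDash n$ with $\mathrm{Peak}(\alpha)\subseteq \mathrm{Des}(\beta)\triangle(\mathrm{Des}(\beta)+1)$ ($X+1=\{x+1:x\in X\}$). The peak algebra $\mathsf{Peak}$ has ($\mathbb{C}$-)basis the functions $K_\alpha$, $\alpha$ a peak composition; for the empty composition, $K_\emptyset=\widetilde{\mathcal{S}}_\emptyset=1$. Algebras. $H_n(0)$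 is the $\mathbb{C}$-algebra with generators $\pi_1,\dots,\pi_{n-1}$ and relations $\pi_i^2=-\pi_i$, $\pi_i\pi_j=\pi_j\pi_i$ for $|i-j|\ge2$, $\pi_i\pi_{i+1}\pi_i=\pi_{i+1}\pi_i\pi_{i+1}$. $HCl_n(0)$ is generated by $\pi_1,\dots,\pi_{n-1}$ (with these relations) and $c_1,\dots,c_n$ with $c_i^2=-1$, $c_ic_j=-c_jc_i$ for $i\ne j$, and $\pi_ic_j=c_j\pi_i$ for $j\ne i,i+1$, $\pi_ic_i=c_{i+1}\pi_i$, $(\pi_i+1)c_{i+1}=c_i(\pi_i+1)$. It is a superalgebra with $\pi_i$ of degree $0$, $c_j$ of degree $1$. Characteristic. For $\alpha\vDash n$, $\mathbf{F}_\alpha=\mathbb{C}v_\alpha$ is the simple $H_n(0)$-module with $\pi_iv_\alpha=-v_\alpha$ if $i\in\mathrm{Des}(\alpha)$ and $0$ otherwise, and $\mathbf{M}_\alpha$ is the $HCl_n(0)$-supermodule induced from $\mathbf{F}_\alpha$. The peak characteristic $\widetilde{ch}$ is the isomorphism of Bergeron, Hivert and Thibon from $\bigoplus_n\mathcal{G}_0(HCl_n(0))$ (Grothendieck groups of finite-dimensional supermodules) to $\mathsf{Peak}$, which satisfies $\widetilde{ch}([\mathbf{M}_\alpha])=K_{\mathrm{comp}_n(\mathrm{Peak}(\alpha))}$ for $\alpha\vDash n$. Diagram modules. Let $D$ be a diagram of $n$ boxes with a reading order (a total order on the boxes). A standard filling is a bijective assignment of $1,\dots,n$ to the boxes; $\mathrm{rw}(T)$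 is the permutation given by the entries of $T$ in reading order from left to right; $s_iT$ exchanges the entries $i,i+1$ of $T$. For a nonempty set $\mathcal{T}$ of standard fillings and $T\in\mathcal{T}$, $\mathrm{Des}(T)$ is the set of $i\in[n-1]$ with $i$ to the right of $i+1$ in $\mathrm{rw}(T)$, and $\mathrm{Peak}(T)=\mathrm{Peak}(\mathrm{Des}(T))$. Elements of $[n-1]\setminus\mathrm{Des}(T)$ are ascents; an ascent $i$ is attacking if $s_iT\notin\mathcal{T}$ and nonattacking otherwise. $T$ has an ascent in positions $(r,s)$ if $r<s$ and $\mathrm{rw}(T)_s-\mathrm{rw}(T)_r=1$. $\mathcal{T}$ is ascent-compatible if whenever $T,T'\in\mathcal{T}$ both have an ascent in positions $(r,s)$, it is attacking in $T$ if and only if it is attacking in $T'$. In that case $\mathbf{N}_{\mathcal{T}}$ is the $H_n(0)$-module on the $\mathbb{C}$-span of $\mathcal{T}$ with $\pi_iT=-T$ if $i\in\mathrm{Des}(T)$, $0$ if $i$ is an attacking ascent, $s_iT$ if $i$ is a nonattacking ascent; and $\widetilde{\mathbf{N}}_{\mathcal{T}}=\mathrm{Ind}_{H_n(0)}^{HCl_n(0)}\mathbf{N}_{\mathcal{T}}$. Tableaux. $D(\alpha)$ is the left-justified array with $\alpha_i$ boxes in row $i$, rows numbered from bottom to top; $T(c,r)$ is the entry in column $c$, row $r$. $\mathsf{SYCT}(\alpha)$ is the set of standard fillings $T$ of $D(\alpha)$ such that: (SYCT1) entries increase from left to right along rows; (SYCT2) entries increase from bottom to top in the first column; (SYCT3)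 if boxes $(c,r)$ and $(c+1,r')$ with $r'<r$ are in $D(\alpha)$ and $T(c,r)<T(c+1,r')$, then $(c+1,r)$ is in $D(\alpha)$ and $T(c+1,r)<T(c+1,r')$. For a peak composition $\alpha\vDash n$, $\mathsf{SPYCT}(\alpha)$ is the set of $T\in\mathsf{SYCT}(\alpha)$ such that for every $1\le k\le n$ the boxes with entries at most $k$ form the diagram of a peak composition. The reading order reads the first column from top to bottom and each subsequent column from bottom to top, columns in order from left to right. $\mathsf{SPYCT}(\alpha)$ is ascent-compatible for this reading order. The peak Young quasisymmetric Schur function is $\widetilde{\mathcal{S}}_\alpha=\widetilde{ch}([\widetilde{\mathbf{N}}_{\mathsf{SPYCT}(\alpha)}])$; explicitly, $\widetilde{\mathcal{S}}_\alpha=\sum_{T\in\mathsf{SPYCT}(\alpha)}K_{\mathrm{comp}_n(\mathrm{Peak}(T))}$. *)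

(* Defs.v *)
From HB Require Import structures.
From mathcomp Require Import all_boot all_order all_algebra.
From mathcomp Require Import finmap multiset complex functions reals.

Set Implicit Arguments.
Unset Strict Implicit.
Unset Printing Implicit Defensive.

Import GRing.Theory.
Local Open Scope ring_scope.

Section Compositions.
Local Open Scope nat_scope.

Definition is_comp (al : seq nat) : bool := all (leq 1) al.

Definition is_peak_comp (al : seq nat) : bool :=
  is_comp al && all (leq 2) (take (size al).-1 al).

(* The compositions of n.+2 arise from those of n.+1 by prepending a part 1
   or by adding 1 to the first part; see mem_compositions. *)
Fixpoint compositions (n : nat) : seq (seq nat) :=
  match n with
  | 0 => [:: [::]]
  | 1 => [:: [:: 1]]
  | n'.+1 =>
      [seq 1 :: be | be <- compositions n'] ++
      [seq (head 0 be).+1 :: behead be | be <- compositions n']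
  end.

(* Finite sets of positive integers are represented by increasing lists. *)
Definition Des (al : seq nat) : seq nat :=
  take (size al).-1 (scanl addn 0 al).

Definition comp_of (n : nat) (X : seq nat) : seq nat :=
  if n is 0 then [::] else pairmap (fun a b => b - a) 0 (rcons X n).

Definition Peak (X : seq nat) : seq nat :=
  [seq i <- X | (1 < i) && (i.-1 \notin X)].

Definition in_symdiff_shift (X : seq nat) (i : nat) : bool :=
  (i \in X) (+) (i \in map succn X).

Lemma compositions_sound n be :
  be \in compositions n -> is_comp be && (sumn be == n).
Proof.
rewrite /is_comp.
elim: n be => [|[|n] IH] be; rewrite /= ?inE; [by move/eqP=> ->..|].
rewrite mem_cat => /orP[] /mapP[ga /IH /andP[cg /eqP sg] ->].
  by rewrite /= cg sg add1n eqxx.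
case: ga cg sg => [|a ga] //= /andP[a0 cg] sg.
by rewrite addSn sg cg eqxx.
Qed.

Lemma mem_compositions n be :
  (be \in compositions n) = is_comp be && (sumn be == n).
Proof.
apply/idP/idP; first exact: compositions_sound.
move=> /andP[+ /eqP]; rewrite /is_comp.
elim: n be => [|[|n] IH] be.
- by case: be => [|[]].
- case: be => [|[|[|a]] be] //=.
  by case: be => [|[]].
- case: be => [|[|[|a]] be] //.
    by move=> cb [] sb; rewrite mem_cat (map_f (cons 1)) // IH.
  move=> cb [] sb; rewrite mem_cat; apply/orP; right.
  by apply/mapP; exists (a.+1 :: be) => //; apply: IH; rewrite //= addSn sb.
Qed.

Lemma compositions_uniq n : uniq (compositions n).
Proof.
elim: n => [|[|n] IH] //.
change (uniq ([seq 1 :: be | be <- compositions n.+1] ++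
      [seq (head 0 be).+1 :: behead be | be <- compositions n.+1])).
rewrite cat_uniq map_inj_uniq ?IH ?andTb; last by move=> x y [].
apply/andP; split.
  apply/hasPn => _ /mapP[ga /compositions_sound/andP[cg sg] ->].
  by apply/mapP=> -[de _ []]; case: ga cg sg => [|[|a] ga].
rewrite map_inj_in_uniq // => x y /compositions_sound/andP[_ sx].
move=> /compositions_sound/andP[_ sy].
by case: x sx => // a x _; case: y sy => // b y _ [-> ->].
Qed.

End Compositions.

(* Formal power series in x_1, x_2, ... over the complex numbers: a multiset
   of indices is a monomial, and a series maps a monomial to its coefficient. *)
Notation powser R := (multiset nat -> R[i]).

Section Functions.
Variable R : realType.

(* x_{i_1} ... x_{i_n}, for w = [:: i_1; ...; i_n], is a term of F_al *)
Definition F_term (al w : seq nat) : bool :=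
  [&& all (leq 1) w, size w == sumn al, sorted leq w
    & all (fun j => nth 0 w j.-1 < nth 0 w j)%N (Des al)].

(* The words w whose monomial is m are the rearrangements of m. *)
Definition F_fun (al : seq nat) : powser R :=
  fun m => (count (F_term al) (permutations m))%:R.

Definition K_fun (al : seq nat) : powser R :=
  if al is [::] then F_fun [::] else
    2%:R ^+ (size (Peak (Des al))).+1 *:
      \sum_(be <- compositions (sumn al)
             | all (in_symdiff_shift (Des be)) (Peak (Des al))) F_fun be.

Definition in_span (P : pred (seq nat)) (f : seq nat -> powser R)
    (g : powser R) : Prop :=
  exists (s : seq (seq nat)) (a : seq nat -> R[i]),
    all P s /\ g = \sum_(al <- s) a al *: f al.

Definition lin_indep (P : pred (seq nat)) (f : seq nat -> powser R) : Prop :=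
  forall (s : seq (seq nat)) (a : seq nat -> R[i]),
    uniq s -> all P s -> \sum_(al <- s) a al *: f al = 0 ->
    forall al, al \in s -> a al = 0.

Definition peak_algebra : powser R -> Prop := in_span is_peak_comp K_fun.

Definition is_basis (P : pred (seq nat)) (f : seq nat -> powser R)
    (W : powser R -> Prop) : Prop :=
  lin_indep P f /\ (forall g, W g <-> in_span P f g).

End Functions.

(* Finite-dimensional modules over the algebras H_n(0) and HCl_n(0), given by
   generators acting subject to the defining relations.  Generators are
   numbered from 1 as in the presentation; the values of pi and c outside
   1 <= i < n, resp. 1 <= j <= n, are irrelevant. *)
Record hmodule (R : realType) (n : nat) := HModule {
  hspace :> vectType R[i];
  hpi : nat -> 'End(hspace);
  hpi_quad : forall i, (0 < i < n)%N ->
    forall v, hpi i (hpi i v) = - hpi i v;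
  hpi_comm : forall i j, (0 < i < n)%N -> (0 < j < n)%N -> (i.+2 <= j)%N ->
    forall v, hpi i (hpi j v) = hpi j (hpi i v);
  hpi_braid : forall i, (0 < i)%N -> (i.+1 < n)%N ->
    forall v, hpi i (hpi i.+1 (hpi i v)) = hpi i.+1 (hpi i (hpi i.+1 v))
}.

(* sgrade false and sgrade true are the even and the odd part. *)
Record smodule (R : realType) (n : nat) := SModule {
  shmod :> hmodule R n;
  sc : nat -> 'End(shmod);
  sgrade : bool -> {vspace shmod};
  sc_sqr : forall j, (0 < j <= n)%N -> forall v, sc j (sc j v) = - v;
  sc_anti : forall j k, (0 < j <= n)%N -> (0 < k <= n)%N -> j != k ->
    forall v, sc j (sc k v) = - sc k (sc j v);
  spi_sc_far : forall i j, (0 < i < n)%N -> (0 < j <= n)%N ->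
    j != i -> j != i.+1 ->
    forall v, hpi shmod i (sc j v) = sc j (hpi shmod i v);
  spi_sc : forall i, (0 < i < n)%N ->
    forall v, hpi shmod i (sc i v) = sc i.+1 (hpi shmod i v);
  spi_scS : forall i, (0 < i < n)%N ->
    forall v, hpi shmod i (sc i.+1 v) + sc i.+1 v = sc i (hpi shmod i v + v);
  sgrade_add : (sgrade false + sgrade true)%VS = fullv;
  sgrade_cap : (sgrade false :&: sgrade true)%VS = 0%VS;
  spi_grade : forall i b, (0 < i < n)%N ->
    (hpi shmod i @: sgrade b <= sgrade b)%VS;
  sc_grade : forall j b, (0 < j <= n)%N ->
    (sc j @: sgrade b <= sgrade (~~ b))%VS
}.

Section Modules.
Variables (R : realType) (n : nat).

Definition is_hhom (N N' : hmodule R n) (f : 'Hom(N, N')) : Prop :=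
  forall i, (0 < i < n)%N -> forall v, f (hpi N i v) = hpi N' i (f v).

Definition is_shom (M M' : smodule R n) (f : 'Hom(M, M')) : Prop :=
  [/\ is_hhom f,
      forall j, (0 < j <= n)%N -> forall v, f (sc M j v) = sc M' j (f v)
    & forall b, (f @: sgrade M b <= sgrade M' b)%VS].

(* M is HCl_n(0) (x)_{H_n(0)} N, N being purely even, as characterized up to
   isomorphism by its universal property; eta is v |-> 1 (x) v. *)
Definition is_induced (N : hmodule R n) (M : smodule R n) : Prop :=
  exists eta : 'Hom(N, M),
    [/\ is_hhom eta, (limg eta <= sgrade M false)%VS
      & forall (V : smodule R n) (f : 'Hom(N, V)),
          is_hhom f -> (limg f <= sgrade V false)%VS ->
          exists! g : 'Hom(M, V), is_shom g /\ (g \o eta)%VF = f].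

Definition is_short_exact (M' M M'' : smodule R n)
    (f : 'Hom(M', M)) (g : 'Hom(M, M'')) : Prop :=
  [/\ is_shom f, is_shom g, lker f = 0%VS, limg f = lker g
    & limg g = fullv].

(* The one-dimensional module F_al, for al a composition of n. *)
Definition is_simple_F (al : seq nat) (N : hmodule R n) : Prop :=
  exists v : N, basis_of fullv [:: v] /\
    forall i, (0 < i < n)%N -> hpi N i v = if i \in Des al then - v else 0.

(* Standard fillings of a diagram with n boxes are stored as their reading
   words, i.e. as rearrangements of [:: 1; ...; n]. *)
Definition swap (i : nat) (T : seq nat) : seq nat :=
  [seq if x == i then i.+1 else if x == i.+1 then i else x | x <- T].

Definition DesT (T : seq nat) : seq nat :=
  [seq i <- iota 1 (size T).-1 | (index i.+1 T < index i T)%N].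

(* N is the module N_TT spanned by a (duplicate-free) list TT of fillings. *)
Definition is_diagram_module (TT : seq (seq nat)) (N : hmodule R n) : Prop :=
  exists b : seq nat -> N, basis_of fullv [seq b T | T <- TT] /\
    forall T, T \in TT -> forall i, (0 < i < n)%N ->
      hpi N i (b T) = if i \in DesT T then - b T
                      else if swap i T \in TT then b (swap i T) else 0.

End Modules.

Section Tableaux.
Local Open Scope nat_scope.

(* The boxes (c, r) of D(al), listed in the reading order. *)
Definition boxes (al : seq nat) : seq (nat * nat) :=
  [seq (1, r) | r <- rev (iota 1 (size al))] ++
  [seq (c, r) | c <- iota 2 (sumn al).-1,
                r <- [seq r <- iota 1 (size al) | c <= nth 0 al r.-1]].

Definition entry (al T : seq nat) (b : nat * nat) : nat :=
  nth 0 T (index b (boxes al)).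

Definition is_SYCT (al T : seq nat) : bool :=
  let D := boxes al in let t c r := entry al T (c, r) in
  [&& perm_eq T (iota 1 (sumn al)),
      all (fun b : nat * nat => let (c, r) := b in
        ((c.+1, r) \in D) ==> (t c r < t c.+1 r)) D,
      all (fun b : nat * nat => let (c, r) := b in
        (c == 1) && ((1, r.+1) \in D) ==> (t 1 r < t 1 r.+1)) D
    & all (fun b : nat * nat => let (c, r) := b in
        all (fun r' =>
          [&& r' < r, (c.+1, r') \in D & t c r < t c.+1 r'] ==>
          ((c.+1, r) \in D) && (t c.+1 r < t c.+1 r'))
        (iota 1 (size al))) D].

Definition is_SPYCT (al T : seq nat) : bool :=
  is_SYCT al T &&
  all (fun k => has (fun be => is_peak_comp be &&
                       perm_eq [seq b <- boxes al | entry al T b <= k]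
                               (boxes be))
                    (compositions k))
      (iota 1 (sumn al)).

Definition SPYCT (al : seq nat) : seq (seq nat) :=
  [seq T <- permutations (iota 1 (sumn al)) | is_SPYCT al T].

End Tableaux.

(* A homomorphism from the Grothendieck groups of finite-dimensional
   HCl_n(0)-supermodules to the peak algebra, given on modules as a function
   additive on short exact sequences, with the values on the modules M_al
   that characterize the peak characteristic. *)
Definition is_peak_characteristic (R : realType)
    (ch : forall n, smodule R n -> powser R) : Prop :=
  [/\ forall n (M : smodule R n), peak_algebra (ch n M),
      forall n (M' M M'' : smodule R n) (f : 'Hom(M', M)) (g : 'Hom(M, M'')),
        is_short_exact f g -> ch n M = ch n M' + ch n M''
    & forall (al : seq nat) (N : hmodule R (sumn al)) (M : smodule R (sumn al)),
        is_comp al -> is_simple_F al N -> is_induced N M ->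
        ch (sumn al) M = K_fun R (comp_of (sumn al) (Peak (Des al)))].

(* f is the peak Young quasisymmetric Schur function of al, relative to ch. *)
Definition is_peak_young_schur (R : realType)
    (ch : forall n, smodule R n -> powser R) (al : seq nat) (f : powser R)
    : Prop :=
  exists (N : hmodule R (sumn al)) (M : smodule R (sumn al)),
    [/\ is_diagram_module (SPYCT al) N, is_induced N M
      & f = ch (sumn al) M].

(* Main.v *)
(** Induction from H_n(0) to HCl_n(0) is exact, because HCl_n(0) is free over
    H_n(0) with basis the products of the c_j: we realize the induced module
    of N as the Clifford algebra tensored with N.  Removing from a diagram
    module the filling that comes first (nonattacking ascents lead away from
    it) leaves a submodule, with a simple quotient; hence the characteristic
    of the induced module is the sum of the K_{comp_n(Peak(T))}.

    Let mu(X) be the sum of the n - p over p in X.  Let T be a standard peak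
    Young composition tableau of shape al and a_1 < a_2 < ... its first
    column.  Since the second entry of row r lies between a_r and a_{r+1},
    a_r is not a descent and a_{r+1} - 1 is, so there is a peak between a_r
    and a_{r+1}; it is at most al_1 + ... + al_r because the entries
    below a_{r+1} lie in the first r rows.  Hence mu(Peak(T)) is at least
    mu(Des(al)), with equality only if Peak(T) = Des(al), which occurs for the
    tableau filled row by row.  So the expansion into peak functions is
    triangular with positive diagonal.  Similarly the coefficient in K_al of
    the monomial with exponents P vanishes unless Des(al) is contained in the
    union of Des(P) and Des(P) + 1, whence mu(Des(al)) <= mu(Des(P)) with
    equality only for al = P. *)
Require Import Defs.
From HB Require Import structures.
From mathcomp Require Import all_boot all_order all_algebra.
From mathcomp Require Import finmap multiset boolp complex functions reals ring zify.
Set Implicit Arguments.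
Unset Strict Implicit.
Unset Printing Implicit Defensive.
Import GRing.Theory Num.Theory.
Import VectorInternalTheory.
Local Open Scope ring_scope.

(** * Clifford algebras tensored with a vector space *)

Section Coordinates.
Variables (F : fieldType) (V : vectType F).
Implicit Types u v : V.

Definition vcoord (i : 'I_(dim V)) v : F := v2r v 0 i.

Lemma vcoord_inj u v : (forall i, vcoord i u = vcoord i v) -> u = v.
Proof. by move=> h; apply: v2r_inj; apply/rowP. Qed.

Lemma vcoordD i u v : vcoord i (u + v) = vcoord i u + vcoord i v.
Proof. by rewrite /vcoord linearD mxE. Qed.

Lemma vcoordN i u : vcoord i (- u) = - vcoord i u.
Proof. by rewrite /vcoord linearN mxE. Qed.

Lemma vcoord0 i : vcoord i 0 = 0.
Proof. by rewrite /vcoord linear0 mxE. Qed.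
End Coordinates.

(** Linear identities between abstract vectors are checked in each coordinate, where [ring]
    applies. *)
Ltac vect_ring :=
  apply: vcoord_inj => ?; rewrite ?(vcoordD, vcoordN, vcoord0); ring.

Section Fock.
Variable F : fieldType.

(* A pair (x, y) stands for x + c_{k+1} y, so that [fock V k] is the tensor
   product of the Clifford algebra on c_1, ..., c_k with V. *)
Fixpoint fock (V : vectType F) (k : nat) : vectType F :=
  if k is k'.+1 then (fock V k' * fock V k')%type else V.

Section Operators.
Variable V : vectType F.

(** Left multiplication by c_j. The first branch is c_{k+1} (x + c_{k+1} y) = - y + c_{k+1} x; in
    the second the sign comes from moving c_j past c_{k+1}. *)
Fixpoint cliff (k j : nat) : fock V k -> fock V k :=
  match k with
  | 0 => fun=> 0
  | k'.+1 => fun u => if j == k'.+1 then (- u.2, u.1)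
                      else (cliff j u.1, - cliff j u.2)
  end.

(** Contraction with c_j: the odd derivation of the Clifford factor that sends c_j to 1 and the
    other generators to 0. *)
Fixpoint annih (k j : nat) : fock V k -> fock V k :=
  match k with
  | 0 => fun=> 0
  | k'.+1 => fun u => if j == k'.+1 then (u.2, 0)
                      else (annih j u.1, - annih j u.2)
  end.

Fixpoint parity (k : nat) : fock V k -> fock V k :=
  match k with
  | 0 => id
  | k'.+1 => fun u => (parity u.1, - parity u.2)
  end.

Fixpoint vac (k : nat) : V -> fock V k :=
  match k with 0 => id | k'.+1 => fun v => (vac k' v, 0) end.

Fact cliff_linear k j : linear (@cliff k j).
Proof.
elim: k => [|k IH] a u v /=; first by rewrite scaler0 addr0.
by case: eqP => _; congr pair => //=; rewrite ?IH ?opprD ?scalerN.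
Qed.
HB.instance Definition _ k j :=
  GRing.isLinear.Build F (fock V k) (fock V k) _ (@cliff k j) (@cliff_linear k j).

Fact annih_linear k j : linear (@annih k j).
Proof.
elim: k => [|k IH] a u v /=; first by rewrite scaler0 addr0.
by case: eqP => _; congr pair => //=; rewrite ?IH ?opprD ?scalerN ?scaler0 ?addr0.
Qed.
HB.instance Definition _ k j :=
  GRing.isLinear.Build F (fock V k) (fock V k) _ (@annih k j) (@annih_linear k j).

Fact parity_linear k : linear (@parity k).
Proof.
elim: k => [|k IH] a u v //=.
by congr pair => //=; rewrite ?IH ?opprD ?scalerN.
Qed.
HB.instance Definition _ k :=
  GRing.isLinear.Build F (fock V k) (fock V k) _ (@parity k) (@parity_linear k).

Fact vac_linear k : linear (@vac k).
Proof.
by elim: k => [|k IH] a u v //=; congr pair => //=; rewrite ?IH ?scaler0 ?addr0.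
Qed.
HB.instance Definition _ k :=
  GRing.isLinear.Build F V (fock V k) _ (@vac k) (@vac_linear k).

Lemma cliffN k j (u : fock V k) : cliff j (- u) = - cliff j u.
Proof. exact: linearN. Qed.

Lemma cliff0 k j : cliff j (0 : fock V k) = 0.
Proof. exact: linear0. Qed.

Lemma annih0 k j : annih j (0 : fock V k) = 0.
Proof. exact: linear0. Qed.

Lemma parity0 k : parity (0 : fock V k) = 0.
Proof. exact: linear0. Qed.

Lemma annihN k j (u : fock V k) : annih j (- u) = - annih j u.
Proof. exact: linearN. Qed.

Lemma parityN k (u : fock V k) : parity (- u) = - parity u.
Proof. exact: linearN. Qed.

Lemma cliff_sqr k j (u : fock V k) : (0 < j <= k)%N -> cliff j (cliff j u) = - u.
Proof.
elim: k u => [|k IH] u; first by case: j.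
case: u => x y /andP[j0]; rewrite leq_eqVlt => /predU1P[->|jk] /=.
  by rewrite eqxx.
by rewrite (ltn_eqF jk) /= (cliffN, annihN, parityN) opprK !IH ?j0.
Qed.

Lemma cliff_anti k j l (u : fock V k) : j != l ->
  cliff j (cliff l u) = - cliff l (cliff j u).
Proof.
elim: k u => [|k IH] u jl /=; first by rewrite oppr0.
case: eqP => [ej|_]; case: eqP => [el|_]; first by rewrite ej el eqxx in jl.
- by congr pair => //=; rewrite ?(cliffN, annihN, parityN) ?opprK.
- by congr pair => //=; rewrite ?(cliffN, annihN, parityN) ?opprK.
- by congr pair => //=; rewrite ?(cliffN, annihN, parityN) ?IH ?opprK.
Qed.

Lemma annih_cliff k j (u : fock V k) : (0 < j <= k)%N ->
  annih j (cliff j u) = u - cliff j (annih j u).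
Proof.
elim: k u => [|k IH] u; first by case: j.
case: u => x y /andP[j0]; rewrite leq_eqVlt => /predU1P[->|jk] /=.
  by rewrite eqxx; congr pair => //=; rewrite ?subr0 ?subrr ?oppr0 ?addr0.
rewrite (ltn_eqF jk) /=; congr pair => //=; first by rewrite IH ?j0.
by rewrite !(cliffN, annihN, parityN) !IH ?j0 //= ?(cliffN, annihN, parityN) ?opprK ?opprB addrC.
Qed.

Lemma annih_cliff_neq k j l (u : fock V k) : j != l ->
  annih j (cliff l u) = - cliff l (annih j u).
Proof.
elim: k u => [|k IH] u jl /=; first by rewrite oppr0.
case: eqP => [ej|_]; case: eqP => [el|_]; first by rewrite ej el eqxx in jl.
- by congr pair => //=; rewrite ?(cliff0, annih0, parity0) ?oppr0.
- by congr pair => //=; rewrite ?(cliffN, annihN, parityN) ?opprK.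
- by congr pair => //=; rewrite ?(cliffN, annihN, parityN) ?IH ?opprK.
Qed.

Lemma parityK k (u : fock V k) : parity (parity u) = u.
Proof. by elim: k u => //= k IH [x y] /=; rewrite (cliffN, annihN, parityN) opprK !IH. Qed.

Lemma parity_cliff k j (u : fock V k) : parity (cliff j u) = - cliff j (parity u).
Proof.
elim: k u => [|k IH] u /=; first by rewrite oppr0.
by case: eqP => _; congr pair => //=; rewrite ?(cliffN, annihN, parityN) ?IH ?opprK.
Qed.

Lemma parity_annih k j (u : fock V k) : parity (annih j u) = - annih j (parity u).
Proof.
elim: k u => [|k IH] u /=; first by rewrite oppr0.
by case: eqP => _; congr pair => //=;
  rewrite ?(annihN, parityN) ?IH ?opprK ?parity0 ?oppr0.
Qed.

Lemma annih_vac k j v : annih j (vac k v) = 0.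
Proof.
elim: k => [|k IH] //=.
by case: eqP => _; congr pair => //=; rewrite ?IH ?(cliff0, annih0, parity0) ?oppr0.
Qed.

Lemma parity_vac k v : parity (vac k v) = vac k v.
Proof. by elim: k => [|k IH] //=; rewrite IH (cliff0, annih0, parity0) oppr0. Qed.

(** The c_j generate the whole space from the copy of V: x + c_{k+1} y is built from x and y, which
    lie one level lower. *)
Lemma fock_ind k (P : fock V k -> Prop) :
    (forall u v, P u -> P v -> P (u + v)) -> (forall v, P (vac k v)) ->
    (forall j u, (0 < j <= k)%N -> P u -> P (cliff j u)) ->
  forall u, P u.
Proof.
elim: k P => [|k IH] P PD Pv Pc //.
have P1 x : P (x, 0).
  apply: (IH (fun x => P (x, 0))) => [a b Pa Pb||j a /andP[j0 jk] Pa].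
  - have -> : (a + b, 0) = (a, 0) + (b, 0) :> fock V k.+1.
      by congr pair => /=; rewrite addr0.
    exact: PD.
  - exact: Pv.
  - have := Pc j _ _ Pa; rewrite j0 (leqW jk) /= (cliff0, annih0, parity0) oppr0.
    by rewrite (ltn_eqF (jk : (j < k.+1)%N)); apply.
case=> x y; have := PD _ _ (P1 x) (Pc k.+1 _ _ (P1 y)).
rewrite leqnn /= eqxx /= oppr0 => /(_ isT).
have -> // : (x, 0) + (0, y) = (x, y) :> fock V k.+1.
by congr pair => /=; rewrite ?addr0 ?add0r.
Qed.

End Operators.

Section Functoriality.
Variables V V' : vectType F.

Fixpoint fockmap (f : V -> V') (k : nat) : fock V k -> fock V' k :=
  match k with
  | 0 => f
  | k'.+1 => fun u => (fockmap f u.1, fockmap f u.2)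
  end.

Fact fockmap_linear (f : {linear V -> V'}) k : linear (@fockmap f k).
Proof.
elim: k => [|k IH] a u v /=; first exact: linearP.
by congr pair => //=; rewrite ?IH.
Qed.
HB.instance Definition _ (f : {linear V -> V'}) k :=
  GRing.isLinear.Build F (fock V k) (fock V' k) _ (@fockmap f k) (@fockmap_linear f k).

Variable f : {linear V -> V'}.

Lemma fockmapN k (u : fock V k) : fockmap f (- u) = - fockmap f u.
Proof. exact: linearN. Qed.

Lemma fockmap0 k : fockmap f (0 : fock V k) = 0.
Proof. exact: linear0. Qed.

Lemma fockmap_cliff k j (u : fock V k) : fockmap f (cliff j u) = cliff j (fockmap f u).
Proof.
elim: k u => [|k IH] u /=; first by rewrite linear0.
by case: eqP => _; congr pair => //=; rewrite ?fockmapN /= ?IH.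
Qed.

Lemma fockmap_annih k j (u : fock V k) : fockmap f (annih j u) = annih j (fockmap f u).
Proof.
elim: k u => [|k IH] u /=; first by rewrite linear0.
by case: eqP => _; congr pair => //=; rewrite ?fockmapN /= ?IH ?fockmap0.
Qed.

Lemma fockmap_parity k (u : fock V k) : fockmap f (parity u) = parity (fockmap f u).
Proof. by elim: k u => [|k IH] u //=; rewrite fockmapN !IH. Qed.

Lemma fockmap_vac k v : fockmap f (vac k v) = vac k (f v).
Proof. by elim: k => [|k IH] //=; rewrite IH fockmap0. Qed.

Lemma fockmap_eq0 k (u : fock V k) :
  (forall v, f v = 0 -> v = 0) -> fockmap f u = 0 -> u = 0.
Proof.
move=> f0; elim: k u => [|k IH] u /=; first exact: f0.
by case: u => x y [/IH -> /IH ->].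
Qed.

Lemma fockmap_onto k (w : fock V' k) :
  (forall v, exists u, f u = v) -> exists u, fockmap f u = w.
Proof.
move=> fS; elim: k w => [|k IH] w /=; first exact: fS.
by case: w => x y; have [a <-] := IH x; have [b <-] := IH y; exists (a, b).
Qed.

End Functoriality.

(** As a vector space [fock V k] is a sum of 2^k copies of V, and [fockmap] acts on each copy
    separately; so exactness is inherited. *)
Lemma fockmap_exact (V V' V'' : vectType F) (f : {linear V -> V'})
    (g : {linear V' -> V''}) k (w : fock V' k) :
    (forall v, g v = 0 <-> exists u, f u = v) ->
  fockmap g w = 0 <-> exists u, fockmap f u = w.
Proof.
move=> fg; elim: k w => [|k IH] w; first exact: fg.
case: w => x y; split=> /=.
  by case=> /IH [a <-] /IH [b <-]; exists (a, b).
by case=> -[a b] [<- <-]; congr pair; apply/IH; [exists a|exists b].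
Qed.

End Fock.

(** * Moving the Hecke generators past the Clifford generators *)

Section Commutation.
Variables (F : fieldType) (W : vectType F).

Lemma lfunD (U : vectType F) (f : 'Hom(U, W)) u v : f (u + v) = f u + f v.
Proof. exact: linearD. Qed.

Lemma lfunN (U : vectType F) (f : 'Hom(U, W)) u : f (- u) = - f u.
Proof. exact: linearN. Qed.

(* On the Clifford factor, [c1 - c2] is left multiplication by
   c_i - c_{i+1}, the operator [1 - (c1 - c2)(d1 - d2)] is the automorphism
   exchanging c_i and c_{i+1}, and [(c1 - c2) d2] is the twisted derivation
   sending c_{i+1} to c_i - c_{i+1} and the other generators to 0. *)
Definition demazure (c1 c2 d1 d2 P : 'End(W)) : 'End(W) :=
  (P - ((c1 - c2) \o ((d1 - d2) \o P)) + ((c1 - c2) \o d2))%VF.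

Lemma demazureE c1 c2 d1 d2 P v : demazure c1 c2 d1 d2 P v =
  P v - (c1 (d1 (P v)) - c1 (d2 (P v)) - (c2 (d1 (P v)) - c2 (d2 (P v))))
  + (c1 (d2 v) - c2 (d2 v)).
Proof. rewrite /demazure !(add_lfunE, opp_lfunE, comp_lfunE) !(lfunD, lfunN); vect_ring. Qed.

Section OneGenerator.
Variables c1 c2 d1 d2 P : 'End(W).
Let X := demazure c1 c2 d1 d2 P.
Hypothesis cc1 : forall v, c1 (c1 v) = - v.
Hypothesis cc2 : forall v, c2 (c2 v) = - v.
Hypothesis cc21 : forall v, c2 (c1 v) = - c1 (c2 v).
Hypothesis dc1 : forall v, d1 (c1 v) = v - c1 (d1 v).
Hypothesis dc2 : forall v, d2 (c2 v) = v - c2 (d2 v).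
Hypothesis d1c2 : forall v, d1 (c2 v) = - c2 (d1 v).
Hypothesis d2c1 : forall v, d2 (c1 v) = - c1 (d2 v).
Hypothesis Pc1 : forall v, P (c1 v) = c1 (P v).
Hypothesis Pc2 : forall v, P (c2 v) = c2 (P v).

Let normal := (lfunD, lfunN, cc1, cc2, cc21, dc1, dc2, d1c2, d2c1, Pc1, Pc2).

Lemma demazure_c1 v : X (c1 v) = c2 (X v).
Proof. rewrite /X !demazureE !normal; vect_ring. Qed.

Lemma demazure_c2 v : X (c2 v) = c1 (X v) + c1 v - c2 v.
Proof. rewrite /X !demazureE !normal; vect_ring. Qed.

Lemma demazure_far (c : 'End(W)) v :
    (forall v, c1 (c v) = - c (c1 v)) -> (forall v, c2 (c v) = - c (c2 v)) ->
    (forall v, d1 (c v) = - c (d1 v)) -> (forall v, d2 (c v) = - c (d2 v)) ->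
    (forall v, P (c v) = c (P v)) ->
  X (c v) = c (X v).
Proof.
move=> h1 h2 h3 h4 h5.
rewrite /X !demazureE !(lfunD, lfunN, h1, h2, h3, h4, h5); vect_ring.
Qed.

Lemma demazure_parity (e : 'End(W)) v :
    (forall v, e (c1 v) = - c1 (e v)) -> (forall v, e (c2 v) = - c2 (e v)) ->
    (forall v, e (d1 v) = - d1 (e v)) -> (forall v, e (d2 v) = - d2 (e v)) ->
    (forall v, e (P v) = P (e v)) ->
  e (X v) = X (e v).
Proof.
move=> h1 h2 h3 h4 h5.
rewrite /X !demazureE !(lfunD, lfunN, h1, h2, h3, h4, h5); vect_ring.
Qed.

End OneGenerator.

Section QuadraticRelation.
Variables c1 c2 X : 'End(W).
Hypothesis Xc1 : forall v, X (c1 v) = c2 (X v).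
Hypothesis Xc2 : forall v, X (c2 v) = c1 (X v) + c1 v - c2 v.

(** The commutation rules alone carry the defect of the quadratic relation past c_1, so the relation
    passes from v to c_1 v. The lemmas that follow do this for the other generators and for the
    defects of the commutation and braid relations. *)
Lemma quad_c1 v : X (X (c1 v)) + X (c1 v) = c1 (X (X v) + X v).
Proof. rewrite !(lfunD, lfunN, Xc1, Xc2); vect_ring. Qed.

Lemma quad_c2 v : X (X (c2 v)) + X (c2 v) = c2 (X (X v) + X v).
Proof. rewrite !(lfunD, lfunN, Xc1, Xc2); vect_ring. Qed.

Lemma far_c1 (Y : 'End(W)) v :
    (forall v, Y (c1 v) = c1 (Y v)) -> (forall v, Y (c2 v) = c2 (Y v)) ->
  X (Y (c1 v)) - Y (X (c1 v)) = c2 (X (Y v) - Y (X v)).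
Proof. move=> h1 h2; rewrite !(lfunD, lfunN, Xc1, Xc2, h1, h2); vect_ring. Qed.

Lemma far_c2 (Y : 'End(W)) v :
    (forall v, Y (c1 v) = c1 (Y v)) -> (forall v, Y (c2 v) = c2 (Y v)) ->
  X (Y (c2 v)) - Y (X (c2 v)) = c1 (X (Y v) - Y (X v)).
Proof. move=> h1 h2; rewrite !(lfunD, lfunN, Xc1, Xc2, h1, h2); vect_ring. Qed.

End QuadraticRelation.

Section BraidRelation.
Variables c1 c2 c3 X Y : 'End(W).
Hypothesis Xc1 : forall v, X (c1 v) = c2 (X v).
Hypothesis Xc2 : forall v, X (c2 v) = c1 (X v) + c1 v - c2 v.
Hypothesis Xc3 : forall v, X (c3 v) = c3 (X v).
Hypothesis Yc1 : forall v, Y (c1 v) = c1 (Y v).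
Hypothesis Yc2 : forall v, Y (c2 v) = c3 (Y v).
Hypothesis Yc3 : forall v, Y (c3 v) = c2 (Y v) + c2 v - c3 v.
Hypothesis XX : forall v, X (X v) = - X v.
Hypothesis YY : forall v, Y (Y v) = - Y v.

Let normal := (lfunD, lfunN, Xc1, Xc2, Xc3, Yc1, Yc2, Yc3).

Lemma braid_c1 v : X (Y (X (c1 v))) - Y (X (Y (c1 v))) = c3 (X (Y (X v)) - Y (X (Y v))).
Proof. rewrite !normal; vect_ring. Qed.

Lemma braid_c2 v : X (Y (X (c2 v))) - Y (X (Y (c2 v))) = c2 (X (Y (X v)) - Y (X (Y v))).
Proof. rewrite !normal; vect_ring. Qed.

Lemma braid_c3 v : X (Y (X (c3 v))) - Y (X (Y (c3 v))) = c1 (X (Y (X v)) - Y (X (Y v))).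
(* Moving c_3 to the left produces squares of X and Y, whose terms cancel only by the quadratic
   relations. *)
Proof. rewrite !normal !(XX, YY) !normal; vect_ring. Qed.

End BraidRelation.
End Commutation.

(** * The induced supermodule *)

Section InducedModule.
Variables (R : realType) (n : nat) (N : hmodule R n).

Definition icliff j : 'End(fock N n) := linfun (@cliff _ N n j).
Definition iannih j : 'End(fock N n) := linfun (@annih _ N n j).
Definition iparity : 'End(fock N n) := linfun (@parity _ N n).
Definition ivac : 'Hom(N, fock N n) := linfun (@vac _ N n).
Definition ifockmap i : 'End(fock N n) := linfun (@fockmap _ _ _ (hpi N i) n).
Definition ipi i : 'End(fock N n) :=
  demazure (icliff i) (icliff i.+1) (iannih i) (iannih i.+1)
    (ifockmap i).

Lemma icliff_sqr j v : (0 < j <= n)%N -> icliff j (icliff j v) = - v.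
Proof. by move=> hj; rewrite !lfunE /= cliff_sqr. Qed.

Lemma icliff_anti j l v : j != l -> icliff j (icliff l v) = - icliff l (icliff j v).
Proof. by move=> jl; rewrite !lfunE /= cliff_anti. Qed.

Lemma iannih_cliff j v : (0 < j <= n)%N ->
  iannih j (icliff j v) = v - icliff j (iannih j v).
Proof. by move=> hj; rewrite !lfunE /= annih_cliff. Qed.

Lemma iannih_cliff_neq j l v : j != l ->
  iannih j (icliff l v) = - icliff l (iannih j v).
Proof. by move=> jl; rewrite !lfunE /= annih_cliff_neq. Qed.

Lemma ifockmap_cliff i j v : ifockmap i (icliff j v) =
  icliff j (ifockmap i v).
Proof. by rewrite !lfunE /= fockmap_cliff. Qed.

Lemma iparity_cliff j v : iparity (icliff j v) = - icliff j (iparity v).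
Proof. by rewrite !lfunE /= parity_cliff. Qed.

Lemma ipi_cliff i v : (0 < i < n)%N -> ipi i (icliff i v) = icliff i.+1 (ipi i v).
Proof.
move=> /andP[i0 lin]; have ii : i != i.+1 by rewrite neq_ltn ltnSn.
have ii' : i.+1 != i by rewrite eq_sym.
apply: demazure_c1 => w; rewrite ?icliff_sqr ?iannih_cliff ?ifockmap_cliff ?i0 ?(ltnW lin) //.
all: by rewrite ?iannih_cliff_neq // icliff_anti.
Qed.

Lemma ipi_cliffS i v : (0 < i < n)%N ->
  ipi i (icliff i.+1 v) = icliff i (ipi i v) + icliff i v - icliff i.+1 v.
Proof.
move=> /andP[i0 lin]; have ii : i != i.+1 by rewrite neq_ltn ltnSn.
have ii' : i.+1 != i by rewrite eq_sym.
apply: demazure_c2 => w; rewrite ?icliff_sqr ?iannih_cliff ?ifockmap_cliff ?i0 ?(ltnW lin) //.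
all: by rewrite ?iannih_cliff_neq // icliff_anti.
Qed.

Lemma ipi_cliff_far i j v : j != i -> j != i.+1 ->
  ipi i (icliff j v) = icliff j (ipi i v).
Proof.
move=> ji jSi; apply: demazure_far => w.
- by rewrite icliff_anti // eq_sym.
- by rewrite icliff_anti // eq_sym.
- by rewrite iannih_cliff_neq // eq_sym.
- by rewrite iannih_cliff_neq // eq_sym.
- by rewrite ifockmap_cliff.
Qed.

Lemma ipi_parity i v : iparity (ipi i v) = ipi i (iparity v).
Proof.
apply: demazure_parity => w; rewrite ?iparity_cliff //.
- by rewrite !lfunE /= parity_annih.
- by rewrite !lfunE /= parity_annih.
- by rewrite !lfunE /= fockmap_parity.
Qed.

Lemma ipi_vac i v : ipi i (ivac v) = ivac (hpi N i v).
Proof.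
rewrite demazureE /icliff /iannih /ivac !lfunE /= fockmap_vac !annih_vac !cliff0.
by rewrite !subr0 addr0.
Qed.

Lemma ind_ind (P : fock N n -> Prop) :
    (forall u v, P u -> P v -> P (u + v)) -> (forall v, P (ivac v)) ->
    (forall j u, (0 < j <= n)%N -> P u -> P (icliff j u)) ->
  forall u, P u.
Proof.
move=> PD Pv Pc; apply: fock_ind => [//|v|j u hj Pu].
- by have := Pv v; rewrite lfunE.
- by have := Pc j u hj Pu; rewrite lfunE.
Qed.

(** On the copy of N the operators [ipi] act as in N, so there the relation is known; its defect
    moves past every c_j, and the c_j generate. The other two relations are proved in the same
    way. *)
Lemma ipi_quad i : (0 < i < n)%N -> forall v, ipi i (ipi i v) = - ipi i v.
Proof.
move=> hi v; apply/eqP; rewrite -addr_eq0; apply/eqP; move: v.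
apply: ind_ind => [u v hu hv|v|j u hj hu].
- by rewrite !lfunD addrACA hu hv addr0.
- by rewrite !ipi_vac hpi_quad // linearN addNr.
have [->|ji] := eqVneq j i.
  rewrite (quad_c1 _ (c2 := icliff i.+1)) ?hu ?linear0 // => w.
  - exact: ipi_cliff.
  - exact: ipi_cliffS.
have [->|jSi] := eqVneq j i.+1.
  rewrite (quad_c2 (c1 := icliff i)) ?hu ?linear0 // => w.
  - exact: ipi_cliff.
  - exact: ipi_cliffS.
by rewrite !ipi_cliff_far // -lfunD hu linear0.
Qed.

Lemma ipi_comm i j : (0 < i < n)%N -> (0 < j < n)%N -> (i.+2 <= j)%N ->
  forall v, ipi i (ipi j v) = ipi j (ipi i v).
Proof.
move=> hi hj ij v; apply/subr0_eq; move: v.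
have ne : [/\ i != j, i != j.+1, i.+1 != j & i.+1 != j.+1].
  by split; rewrite neq_ltn ?(leq_trans _ ij) ?(leq_trans _ (leqW ij)).
have [ne1 ne2 ne3 ne4] := ne.
apply: ind_ind => [u v hu hv|v|l u hl hu].
- by rewrite !lfunD opprD addrACA hu hv addr0.
- by rewrite !ipi_vac hpi_comm // subrr.
have fi w : ipi j (icliff i w) = icliff i (ipi j w) by apply: ipi_cliff_far.
have fSi w : ipi j (icliff i.+1 w) = icliff i.+1 (ipi j w) by apply: ipi_cliff_far.
have fj w : ipi i (icliff j w) = icliff j (ipi i w).
  by apply: ipi_cliff_far; rewrite eq_sym.
have fSj w : ipi i (icliff j.+1 w) = icliff j.+1 (ipi i w).
  by apply: ipi_cliff_far; rewrite eq_sym.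
have [->|li] := eqVneq l i.
  by rewrite (far_c1 (c2 := icliff i.+1)) ?hu ?linear0 // => w; rewrite ?ipi_cliff ?ipi_cliffS.
have [->|lSi] := eqVneq l i.+1.
  by rewrite (far_c2 (c1 := icliff i)) ?hu ?linear0 // => w; rewrite ?ipi_cliff ?ipi_cliffS.
have [->|lj] := eqVneq l j.
  (* Here [ipi j] plays the part of X and [ipi i] that of Y, which reverses the sign of the
     commutator. *)
  apply: oppr_inj; rewrite opprB oppr0.
  rewrite (far_c1 (c2 := icliff j.+1)) // => [|w]; rewrite ?ipi_cliff ?ipi_cliffS //.
  by rewrite -opprB hu oppr0 linear0.
have [->|lSj] := eqVneq l j.+1.
  apply: oppr_inj; rewrite opprB oppr0.
  rewrite (far_c2 (c1 := icliff j)) // => [|w]; rewrite ?ipi_cliff ?ipi_cliffS //.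
  by rewrite -opprB hu oppr0 linear0.
rewrite (ipi_cliff_far _ lj lSj) (ipi_cliff_far _ li lSi) (ipi_cliff_far _ li lSi).
by rewrite (ipi_cliff_far _ lj lSj) -lfunN -lfunD hu linear0.
Qed.

Lemma ipi_braid i : (0 < i)%N -> (i.+1 < n)%N ->
  forall v, ipi i (ipi i.+1 (ipi i v)) = ipi i.+1 (ipi i (ipi i.+1 v)).
Proof.
move=> i0 lin v; apply/subr0_eq; move: v.
have hi : (0 < i < n)%N by rewrite i0 ltnW.
have hSi : (0 < i.+1 < n)%N by [].
have ne : [/\ i != i.+1, i != i.+2 & i.+2 != i.+1].
  by split; rewrite neq_ltn !ltnS ?leqnn ?leqnSn ?orbT.
have [ne1 ne2 ne3] := ne; have ne4 : i.+2 != i by rewrite eq_sym.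
apply: ind_ind => [u v hu hv|v|l u hl hu].
- by rewrite !lfunD opprD addrACA hu hv addr0.
- by rewrite !ipi_vac hpi_braid // subrr.
have X1 w := ipi_cliff w hi; have X2 w := ipi_cliffS w hi.
have X3 w := ipi_cliff_far w ne4 ne3.
have Y1 w := ipi_cliff_far w ne1 ne2.
have Y2 w := ipi_cliff w hSi; have Y3 w := ipi_cliffS w hSi.
have [->|li] := eqVneq l i.
  by rewrite (braid_c1 X1 X3 Y1 Y2) hu linear0.
have [->|lSi] := eqVneq l i.+1.
  by rewrite (braid_c2 X1 X2 X3 Y1 Y2 Y3) hu linear0.
have [->|lSSi] := eqVneq l i.+2.
  by rewrite (braid_c3 X2 X3 Y1 Y2 Y3 (ipi_quad hi) (ipi_quad hSi)) hu linear0.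
have fX w := ipi_cliff_far w li lSi; have fY w := ipi_cliff_far w lSi lSSi.
by rewrite !(fX, fY) -lfunN -lfunD hu linear0.
Qed.

Definition ind_hmodule : hmodule R n := HModule ipi_quad ipi_comm ipi_braid.

Definition igrade (b : bool) : {vspace fock N n} :=
  lker (iparity - (if b then -1 else 1) *: \1)%VF.

Lemma mem_igrade b v : (v \in igrade b) = (iparity v == (if b then -1 else 1) *: v).
Proof. by rewrite memv_ker add_lfunE opp_lfunE scale_lfunE id_lfunE subr_eq0. Qed.

Lemma igrade_add : (igrade false + igrade true)%VS = fullv.
Proof.
apply/vspaceP => v; rewrite memvf.
have -> : v = 2^-1 *: (v + iparity v) + 2^-1 *: (v - iparity v).
  by rewrite -scalerDr addrACA subrr addr0 -mulr2n -[v *+ 2]scaler_nat scalerK ?pnatr_eq0.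
have PK w : iparity (iparity w) = w by rewrite !lfunE /= parityK.
apply: memv_add; apply: memvZ; rewrite mem_igrade lfunD ?lfunN PK.
  by rewrite scale1r addrC.
by rewrite scaleN1r opprB addrC.
Qed.

Lemma igrade_cap : (igrade false :&: igrade true)%VS = 0%VS.
Proof.
apply/eqP; rewrite -subv0; apply/subvP => v /memv_capP[v0 v1]; rewrite memv0.
have ev : iparity v = v by move: v0; rewrite mem_igrade /= scale1r => /eqP.
have h : v = - v by move: v1; rewrite mem_igrade /= scaleN1r ev => /eqP.
have /eqP : 2 *: v = 0 by rewrite scaler_nat mulr2n {1}h addNr.
by rewrite scaler_eq0 pnatr_eq0.
Qed.

Lemma ipi_grade i b : (0 < i < n)%N -> (ipi i @: igrade b <= igrade b)%VS.
Proof.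
move=> _; apply/subvP => _ /memv_imgP[v hv ->]; move: hv.
by rewrite !mem_igrade ipi_parity => /eqP ->; rewrite linearZ.
Qed.

Lemma icliff_grade j b : (0 < j <= n)%N -> (icliff j @: igrade b <= igrade (~~ b))%VS.
Proof.
move=> _; apply/subvP => _ /memv_imgP[v hv ->]; move: hv.
rewrite !mem_igrade iparity_cliff => /eqP ->; rewrite linearZ -scaleNr.
by case: b; rewrite ?opprK.
Qed.

Definition induced : smodule R n.
Proof.
apply: (@SModule R n ind_hmodule icliff igrade) => /=.
- by move=> j hj v; apply: icliff_sqr.
- by move=> j k _ _ jk v; apply: icliff_anti.
- by move=> i j _ _ ji jSi v; apply: ipi_cliff_far.
- by move=> i hi v; apply: ipi_cliff.
- by move=> i hi v; rewrite ipi_cliffS // subrK lfunD.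
- exact: igrade_add.
- exact: igrade_cap.
- exact: ipi_grade.
- exact: icliff_grade.
Defined.

End InducedModule.

(** * The universal property and the exactness of induction *)

Section FockLift.
Variables (F : fieldType) (V W : vectType F) (c : nat -> 'End(W)) (f : 'Hom(V, W)).

(** The only possible extension of f that commutes with the Clifford generators. *)
Fixpoint focklift k : fock V k -> W :=
  match k with
  | 0 => f
  | k'.+1 => fun u => focklift u.1 + c k'.+1 (focklift u.2)
  end.

Fact focklift_linear k : linear (@focklift k).
Proof.
elim: k => [|k IH] a u v /=; first exact: linearP.
by rewrite !IH linearP scalerDr addrACA.
Qed.
HB.instance Definition _ k :=
  GRing.isLinear.Build F (fock V k) W _ (@focklift k) (@focklift_linear k).

Lemma fockliftN k (u : fock V k) : focklift (- u) = - focklift u.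
Proof. exact: linearN. Qed.

Lemma focklift0 k : focklift (0 : fock V k) = 0.
Proof. exact: linear0. Qed.

Lemma focklift_vac k v : focklift (vac k v) = f v.
Proof. by elim: k => [|k IH] //=; rewrite IH focklift0 linear0 addr0. Qed.

Lemma focklift_cliff n k j (u : fock V k) :
    (forall j, (0 < j <= n)%N -> forall w, c j (c j w) = - w) ->
    (forall j l, (0 < j <= n)%N -> (0 < l <= n)%N -> j != l ->
       forall w, c j (c l w) = - c l (c j w)) ->
  (k <= n)%N -> (0 < j <= k)%N -> focklift (cliff j u) = c j (focklift u).
Proof.
move=> csq canti; elim: k u => [|k IH] u kn; first by case: j.
move=> /andP[j0]; rewrite leq_eqVlt => /predU1P[->|jk] /=.
  by rewrite eqxx /= fockliftN lfunD csq // addrC.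
rewrite (ltn_eqF jk) /= fockliftN !lfunD !IH ?j0 ?(ltnW kn) // lfunN.
by rewrite -canti ?j0 ?(ltn_eqF jk) // (leq_trans _ kn) // ltnW.
Qed.

Lemma focklift_parity (U : bool -> {vspace W}) n k (u : fock V k) b :
    2 != 0 :> F -> (limg f <= U false)%VS ->
    (forall j b, (0 < j <= n)%N -> (c j @: U b <= U (~~ b))%VS) ->
  (k <= n)%N -> parity u = (if b then -1 else 1) *: u -> focklift u \in U b.
Proof.
move=> nz2 fU cU; elim: k u b => [|k IH] u b kn /=.
  case: b => [|_]; last by rewrite (subvP fU) // memv_img // memvf.
  (* V is purely even: an odd vector of V equals its own negative, hence is zero as 2 is
     invertible. *)
  rewrite scaleN1r => h; have : 2 *: u = 0 by rewrite scaler_nat mulr2n {1}h addNr.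
  by move/eqP; rewrite scaler_eq0 (negPf nz2) => /eqP ->; rewrite linear0 mem0v.
case: u => x y [hx hy]; rewrite memvD ?IH ?(ltnW kn) //=.
have /(cU _ (~~ b)) : (0 < k.+1 <= n)%N by [].
rewrite negbK => /subvP; apply; apply/memv_img/IH; first exact: ltnW.
by rewrite -[LHS]opprK hy -scaleNr; case: b {hx hy} => /=; rewrite ?opprK.
Qed.

End FockLift.

Section UniversalProperty.
Variables (R : realType) (n : nat).

Lemma is_hhom_vac (N : hmodule R n) : @is_hhom R n N (induced N) (ivac N).
Proof. by move=> i _ v; rewrite /= ipi_vac. Qed.

(** The extension commutes with pi_i because both modules move pi_i past the c_j by the same rules,
    and it does so on the copy of N. It is unique because the c_j generate. *)
Lemma induced_is_induced (N : hmodule R n) : is_induced N (induced N).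
Proof.
exists (ivac N); split; first exact: is_hhom_vac.
  apply/subvP => _ /memv_imgP[v _ ->].
  by rewrite mem_igrade scale1r !lfunE /= parity_vac.
move=> V f fh fU; pose g : 'Hom(fock N n, V) := linfun (@focklift _ _ _ (sc V) f n).
have gc j u : (0 < j <= n)%N -> g (icliff N j u) = sc V j (g u).
  by move=> hj; rewrite !lfunE /= (@focklift_cliff _ _ _ _ _ n) //;
    [apply: sc_sqr|apply: sc_anti].
have gv v : g (ivac N v) = f v by rewrite !lfunE /= focklift_vac.
exists g; split; first split.
- split=> [i hi|j hj v|b]; last 1 first.
  + apply/subvP => _ /memv_imgP[u + ->]; rewrite mem_igrade !lfunE /= => /eqP hu.
    apply: (@focklift_parity _ _ _ _ _ (sgrade V) n n u b) hu => //; first by rewrite pnatr_eq0.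
    by move=> j b' hj; apply: sc_grade.
  + apply: (@ind_ind _ _ N) => [u v hu hv|v|j u hj hu].
    * by rewrite /= !lfunD hu hv.
    * by rewrite /= ipi_vac !gv fh.
    have [h1 h2] : (0 < i <= n)%N /\ (0 < i.+1 <= n)%N.
      by case/andP: hi => i0 lin; rewrite i0 (ltnW lin).
    have [->|ji] := eqVneq j i.
      by rewrite /= ipi_cliff // !gc // spi_sc // -hu.
    have [->|jSi] := eqVneq j i.+1.
      rewrite /= ipi_cliffS // !lfunD !lfunN /= !gc //.
      apply/eqP; rewrite subr_eq spi_scS //= lfunD.
      by rewrite -hu.
    by rewrite /= ipi_cliff_far // !gc // spi_sc_far // -hu.
  + exact: gc.
- by apply/lfunP => v; rewrite comp_lfunE gv.
move=> g' [[g'h g'c _] g'v]; apply/lfunP; apply: (@ind_ind _ _ N) => [u v hu hv|v|j u hj hu].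
- by rewrite !lfunD hu hv.
- by rewrite gv -g'v comp_lfunE.
- by rewrite gc // g'c // hu.
Qed.

Definition indmap (N N' : hmodule R n) (f : 'Hom(N, N')) :
    'Hom(induced N, induced N') := linfun (@fockmap _ _ _ f n).

Lemma indmap_shom (N N' : hmodule R n) (f : 'Hom(N, N')) :
  is_hhom f -> is_shom (indmap f).
Proof.
move=> fh.
have fC j u : indmap f (icliff N j u) = icliff N' j (indmap f u).
  by rewrite !lfunE /= fockmap_cliff.
have fA j u : indmap f (iannih N j u) = iannih N' j (indmap f u).
  by rewrite !lfunE /= fockmap_annih.
have fP i u : (0 < i < n)%N ->
    indmap f (ifockmap N i u) = ifockmap N' i (indmap f u).
  move=> hi; rewrite !lfunE /=.
  have h k (w : fock N k) :
      fockmap f (fockmap (hpi N i) w) = fockmap (hpi N' i) (fockmap f w).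
    by elim: k w => [|k IH] w /=; [apply: fh|rewrite !IH].
  exact: h.
split=> [i hi v|j hj v|b]; last 1 first.
- apply/subvP => _ /memv_imgP[u + ->].
  have fE : iparity N' (indmap f u) = indmap f (iparity N u).
    by rewrite !lfunE /= fockmap_parity.
  by rewrite !mem_igrade fE => /eqP ->; rewrite linearZ.
- by rewrite /= !demazureE !(lfunD, lfunN) /= !(fC, fA, fP).
- exact: fC.
Qed.

Lemma induced_exact (N' N N'' : hmodule R n) (f : 'Hom(N', N)) (g : 'Hom(N, N'')) :
    is_hhom f -> is_hhom g -> lker f = 0%VS -> limg f = lker g -> limg g = fullv ->
  is_short_exact (indmap f) (indmap g).
Proof.
move=> fh gh f0 fg gS; split; [exact: indmap_shom|exact: indmap_shom|..].
- apply/eqP; rewrite -subv0; apply/subvP => u; rewrite memv_ker memv0 lfunE /=.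
  move/eqP/fockmap_eq0 => -> // v /eqP.
  by rewrite -memv_ker f0 memv0 => /eqP.
- apply/vspaceP => u; rewrite memv_ker lfunE /=.
  have h v : g v = 0 <-> exists w, f w = v.
    split=> [/eqP|[w <-]]; last by apply/eqP; rewrite -memv_ker -fg memv_img ?memvf.
    by rewrite -memv_ker -fg => /memv_imgP[w _ ->]; exists w.
  have [h1 h2] := fockmap_exact u h.
  apply/memv_imgP/eqP => [[w _ hw]|/h1[w hw]]; first by apply/h2; exists w; rewrite hw lfunE.
  by exists w; rewrite ?memvf // lfunE.
- apply/vspaceP => w; rewrite memvf; apply/memv_imgP.
  have [|u hu] := @fockmap_onto _ _ _ g n w; last by exists u; rewrite ?memvf // lfunE.
  move=> v; have: v \in limg g by rewrite gS memvf.
  by move=> /memv_imgP[u _ ->]; exists u.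
Qed.

Lemma shom_id (M : smodule R n) : @is_shom R n M M \1%VF.
Proof. by split=> [i hi v|j hj v|b]; rewrite ?id_lfunE ?lim1g. Qed.

Lemma shom_comp (M M' M'' : smodule R n) (f : 'Hom(M, M')) (g : 'Hom(M', M'')) :
  is_shom f -> is_shom g -> @is_shom R n M M'' (g \o f)%VF.
Proof.
move=> [fh fc fb] [gh gc gb]; split=> [i hi v|j hj v|b].
- by rewrite !comp_lfunE fh ?gh.
- by rewrite !comp_lfunE fc ?gc.
- by rewrite limg_comp (subv_trans _ (gb b)) ?limgS.
Qed.

Lemma shom0 (M M' : smodule R n) : @is_shom R n M M' 0.
Proof. by split=> [i hi v|j hj v|b]; rewrite ?zero_lfunE ?linear0 ?lim0g ?sub0v. Qed.

Lemma induced_iso (N : hmodule R n) (M M' : smodule R n) :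
    is_induced N M -> is_induced N M' ->
  exists f : 'Hom(M, M'), [/\ is_shom f, lker f = 0%VS & limg f = fullv].
Proof.
move=> [eta [etah etag etau]] [eta' [etah' etag' etau']].
have [f [[fs fe] _]] := etau _ _ etah' etag'.
have [g [[gs ge] _]] := etau' _ _ etah etag.
have [h0 [_ u]] := etau _ _ etah etag.
have [h0' [_ u']] := etau' _ _ etah' etag'.
(* Both sides extend [eta] along itself, so the uniqueness clause identifies them. *)
have gf : (g \o f)%VF = \1%VF.
  rewrite -(u (g \o f)%VF); first rewrite -(u \1%VF) //.
    by rewrite comp_lfun1l; split=> //; apply: shom_id.
  by rewrite -comp_lfunA fe ge; split=> //; apply: shom_comp.
have fg' : (f \o g)%VF = \1%VF.
  rewrite -(u' (f \o g)%VF); first rewrite -(u' \1%VF) //.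
    by rewrite comp_lfun1l; split=> //; apply: shom_id.
  by rewrite -comp_lfunA ge fe; split=> //; apply: shom_comp.
exists f; split=> //.
  apply/eqP/lker0P => x y fxy.
  by rewrite -[x]id_lfunE -[y]id_lfunE -gf !comp_lfunE fxy.
apply/vspaceP => w; rewrite memvf -[w]id_lfunE -fg' comp_lfunE.
by rewrite memv_img ?memvf.
Qed.

End UniversalProperty.

(** * Consequences of additivity on short exact sequences *)

Section Characteristic.
Variables (R : realType) (n : nat) (ch : smodule R n -> powser R).
Hypothesis chD : forall (M' M M'' : smodule R n) (f : 'Hom(M', M)) (g : 'Hom(M, M'')),
  is_short_exact f g -> ch M = ch M' + ch M''.

(** For a zero module the sequence M, M, M with zero maps is exact, so ch M = ch M + ch M. *)
Lemma ch_eq0 (M : smodule R n) : fullv = 0%VS :> {vspace M} -> ch M = 0.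
Proof.
move=> M0; apply: (addrI (ch M)); rewrite addr0; apply/esym.
have full0 (U : {vspace M}) : U = 0%VS by apply/eqP; rewrite -subv0 -M0 subvf.
apply: (@chD _ _ _ 0 0); split; try exact: shom0.
- exact: full0.
- by rewrite [LHS]full0 [RHS]full0.
- by rewrite [LHS]full0 [RHS]full0.
Qed.

(** An isomorphism is completed to a short exact sequence by the zero module Z, whose characteristic
    vanishes. *)
Lemma ch_iso (M M' : smodule R n) (f : 'Hom(M, M')) (Z : smodule R n) :
    fullv = 0%VS :> {vspace Z} ->
  is_shom f -> lker f = 0%VS -> limg f = fullv -> ch M' = ch M.
Proof.
move=> Z0 fs f0 f1; rewrite -[RHS]addr0 -(ch_eq0 Z0).
apply: (@chD _ _ _ f 0); split=> //; first exact: shom0.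
- rewrite f1; apply/vspaceP => v.
  by rewrite memvf memv_ker zero_lfunE eqxx.
- by rewrite lim0g Z0.
Qed.

End Characteristic.

(** * Characteristics of diagram modules *)

Section Potential.
Local Open Scope nat_scope.

(* Exchanging an ascent i of T with i + 1 increases [wt T], so the action on a
   diagram module moves fillings to fillings of larger weight. *)
Fixpoint wt (T : seq nat) : nat :=
  if T is x :: s then x * (size s).+1 + wt s else 0.

Lemma swap_id i T : i \notin T -> i.+1 \notin T -> swap i T = T.
Proof.
move=> iT SiT; rewrite /swap -[RHS]map_id; apply/eq_in_map => x xT.
case: eqP xT iT => [-> ->//|_ xT _]; by case: eqP xT SiT => [-> ->|].
Qed.

(** This treats the part of a word to the right of i: there the exchange at most lowers one entry i
    + 1 to i, and the loss is its positional factor, at most [size T]. *)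
Lemma wt_swap_notin i T : uniq T -> i \notin T -> wt T <= wt (swap i T) + size T.
Proof.
elim: T => //= x T IH /andP[xT uT]; rewrite inE negb_or eq_sym => /andP[xi iT].
rewrite (negPf xi) size_map; case: eqP xT => [->|_] xT; last first.
  by rewrite -addnA leq_add2l (leq_trans (IH uT iT)) // leq_add2l.
by rewrite -/(swap i T) swap_id // mulSn -addnA addnC.
Qed.

Lemma wt_swap i T : uniq T -> i.+1 \in T -> index i T < index i.+1 T ->
  wt T < wt (swap i T).
Proof.
elim: T => //= x T IH /andP[xT uT]; rewrite inE size_map -/(swap i T).
case: (eqVneq x i) => [ex|xi].
  have := @wt_swap_notin i T uT; rewrite -ex => /(_ xT) le _ _.
  by rewrite mulSn; move: le; set a := x * _; lia.
case: (eqVneq x i.+1) => [->|xSi]; first by [].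
by rewrite ltnS => /= SiT ind; rewrite ltn_add2l IH.
Qed.

Lemma mem_DesT n T i : perm_eq T (iota 1 n) ->
  (i \in DesT T) = (0 < i < n) && (index i.+1 T < index i T).
Proof.
move=> Tp; rewrite mem_filter (perm_size Tp) size_iota mem_iota andbC.
by congr (_ && _); case: n {Tp} => [|n] /=; rewrite ?add1n //; case: i.
Qed.

Lemma DesT_sorted T : sorted ltn (DesT T).
Proof. by apply: sorted_filter; [apply: ltn_trans|apply: iota_ltn_sorted]. Qed.

Lemma perm_iota_mem n T i : perm_eq T (iota 1 n) -> (i \in T) = (0 < i <= n).
Proof. by move/perm_mem->; rewrite mem_iota add1n ltnS. Qed.

Lemma seq_argmin (I : eqType) (h : I -> nat) (s : seq I) : s != [::] ->
  exists2 x, x \in s & {in s, forall y, h x <= h y}.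
Proof.
elim: s => // x [|y s] IH _; first by exists x => [|z]; rewrite inE // => /eqP->.
have [//|z zs hz] := IH; case: (leqP (h x) (h z)) => xz.
  exists x; first exact: mem_head.
  by move=> t; rewrite inE => /predU1P[->//|/hz]; apply: leq_trans.
exists z; first by rewrite inE zs orbT.
by move=> t; rewrite inE => /predU1P[->|/hz //]; apply: ltnW.
Qed.

End Potential.

(** * Submodules, one-dimensional modules and the removal of one filling *)

Section Submodule.
Variables (R : realType) (n : nat) (N : hmodule R n) (U : {vspace N}).
Hypothesis Ustable : forall i, (0 < i < n)%N -> (hpi N i @: U <= U)%VS.

Definition sub_hpi i : 'End(subvs_of U) :=
  (linfun (vsproj U) \o (hpi N i \o linfun (@vsval _ _ U)))%VF.

Lemma vsval_hpi i u : (0 < i < n)%N -> vsval (sub_hpi i u) = hpi N i (vsval u).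
Proof.
move=> hi; rewrite !comp_lfunE !lfunE /= vsprojK //.
by rewrite (subvP (Ustable hi)) ?memv_img ?subvsP.
Qed.

Fact sub_hpi_quad i : (0 < i < n)%N -> forall v, sub_hpi i (sub_hpi i v) = - sub_hpi i v.
Proof.
by move=> hi v; apply: subvs_inj; rewrite !vsval_hpi // hpi_quad // linearN /= vsval_hpi.
Qed.

Fact sub_hpi_comm i j : (0 < i < n)%N -> (0 < j < n)%N -> (i.+2 <= j)%N ->
  forall v, sub_hpi i (sub_hpi j v) = sub_hpi j (sub_hpi i v).
Proof. by move=> hi hj ij v; apply: subvs_inj; rewrite !vsval_hpi // hpi_comm. Qed.

Fact sub_hpi_braid i : (0 < i)%N -> (i.+1 < n)%N ->
  forall v, sub_hpi i (sub_hpi i.+1 (sub_hpi i v)) = sub_hpi i.+1 (sub_hpi i (sub_hpi i.+1 v)).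
Proof.
move=> i0 lin v; have hi : (0 < i < n)%N by rewrite i0 ltnW.
by apply: subvs_inj; rewrite !vsval_hpi // hpi_braid.
Qed.

Definition submodule : hmodule R n := HModule sub_hpi_quad sub_hpi_comm sub_hpi_braid.

End Submodule.

Section LineModule.
Variables (R : realType) (n : nat) (D : pred nat).

Definition line_hpi i : 'End(R[i]^o) := (if D i then - \1%VF else 0).

Lemma line_hpiE i v : line_hpi i v = if D i then - v else 0.
Proof. by rewrite /line_hpi; case: (D i); rewrite ?opp_lfunE ?id_lfunE ?zero_lfunE. Qed.

Fact line_hpi_quad i : (0 < i < n)%N -> forall v, line_hpi i (line_hpi i v) = - line_hpi i v.
Proof. by move=> _ v; rewrite !line_hpiE; case: (D i); rewrite ?oppr0. Qed.

Fact line_hpi_comm i j : (0 < i < n)%N -> (0 < j < n)%N -> (i.+2 <= j)%N ->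
  forall v, line_hpi i (line_hpi j v) = line_hpi j (line_hpi i v).
Proof. by move=> _ _ _ v; rewrite !line_hpiE; case: (D i); case: (D j); rewrite ?oppr0. Qed.

Fact line_hpi_braid i : (0 < i)%N -> (i.+1 < n)%N ->
  forall v, line_hpi i (line_hpi i.+1 (line_hpi i v)) =
            line_hpi i.+1 (line_hpi i (line_hpi i.+1 v)).
Proof. by move=> _ _ v; rewrite !line_hpiE; case: (D i); case: (D i.+1); rewrite ?oppr0. Qed.

Definition line_module : hmodule R n := HModule line_hpi_quad line_hpi_comm line_hpi_braid.

End LineModule.

(** The coordinate functional of v serves as the quotient map by the span of the other basis
    vectors. *)
Lemma basis_coord (F : fieldType) (V : vectType F) (v : V) X :
    basis_of fullv (v :: X) ->
  exists g : 'Hom(V, F^o), [/\ g v = 1, lker g = <<X>>%VS & limg g = fullv].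
Proof.
move=> bX; have [g0 hg0] := linear_of_free (v :: X) (1 :: nseq (size X) (0 : F^o)).
have := hg0 (basis_free bX); rewrite /= size_nseq => /(_ erefl)[gv gX].
pose g : 'Hom(V, F^o) := linfun g0.
have gv1 : g v = 1 by rewrite lfunE.
have XK : (<<X>> <= lker g)%VS.
  apply/span_subvP => x xX; rewrite memv_ker lfunE /=.
  by have := map_f g0 xX; rewrite gX mem_nseq => /andP[_].
exists g; split=> //.
  apply/eqP; rewrite eqEsubv XK andbT; apply/subvP => w; rewrite memv_ker => /eqP gw.
  have : w \in <<v :: X>>%VS by rewrite (span_basis bX) memvf.
  rewrite span_cons => /memv_addP[_ /vlineP[a ->] [x xX ew]]; move: gw.
  have gx : g x = 0 by apply/eqP; rewrite -memv_ker (subvP XK).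
  rewrite {1}ew linearD linearZ /= gv1 gx addr0 {1}/GRing.scale /= mulr1 => a0.
  by rewrite ew a0 scale0r add0r.
apply/vspaceP => a; rewrite memvf; apply/memv_imgP; exists (a *: v); first exact: memvf.
by rewrite linearZ /= gv1 /GRing.scale /= mulr1.
Qed.


Section ChDiagram.
Variables (R : realType) (n : nat).

(** A nonattacking ascent raises the weight, so none leads to the filling [T0] of least weight. The
    other fillings thus span a submodule, and on the line of [T0] in the quotient every ascent acts
    by 0. *)
Lemma diagram_step (TT : seq (seq nat)) (N : hmodule R n) (T0 : seq nat) :
    is_diagram_module TT N -> {in TT, forall T, perm_eq T (iota 1 n)} ->
    T0 \in TT -> {in TT, forall T, (wt T0 <= wt T)%N} ->
  exists (N' : hmodule R n) (f : 'Hom(N', N))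
    (g : 'Hom(N, line_module R n (fun i => i \in DesT T0))),
    is_diagram_module (rem T0 TT) N' /\ is_short_exact (indmap f) (indmap g).
Proof.
move=> [b [bb bpi]] TTp T0TT T0min.
have uTT : uniq TT by apply: (@map_uniq _ _ b); apply: free_uniq; apply: basis_free bb.
have bb0 : basis_of fullv (b T0 :: [seq b T | T <- rem T0 TT]).
  by rewrite -(perm_basis _ (perm_map b (perm_to_rem T0TT))).
have mem_rem' T : (T \in rem T0 TT) = (T != T0) && (T \in TT).
  by rewrite mem_rem_uniq // inE.
set X := [seq b T | T <- rem T0 TT] in bb0.
have [g [g0 gker gim]] := basis_coord bb0.
(* If i is not a descent, then i precedes i + 1, and by [wt_swap] the result would be heavier than
   T, against minimality. *)
have swapT T i : T \in TT -> (0 < i < n)%N -> i \notin DesT T -> swap i T != T0.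
  move=> TTT /andP[i0 lin]; have Tp := TTp _ TTT; apply: contra => /eqP eT0.
  have mT x := perm_iota_mem x Tp.
  rewrite (mem_DesT _ Tp) i0 lin /= ltnNge; apply/negP => le.
  have ne : index i T != index i.+1 T.
    apply/eqP => e; have := nth_index 0%N (_ : i \in T); rewrite mT i0 ltnW // => /(_ isT).
    by rewrite e nth_index ?mT ?lin // => /eqP; rewrite eqn_leq ltnn.
  have lt : (index i T < index i.+1 T)%N by rewrite ltn_neqAle ne.
  have := wt_swap (_ : uniq T) (_ : i.+1 \in T) lt; rewrite eT0 ltnNge T0min //.
  by rewrite (perm_uniq Tp) iota_uniq mT lin => /(_ isT isT).
have Xpi T i : T \in rem T0 TT -> (0 < i < n)%N -> hpi N i (b T) \in <<X>>%VS.
  rewrite mem_rem' => /andP[TT0 TTT] hi; rewrite bpi //.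
  have inX T' : T' \in TT -> T' != T0 -> b T' \in <<X>>%VS.
    by move=> h1 h2; rewrite memv_span // map_f // mem_rem' h1 h2.
  case: ifP => [_|iD]; first by rewrite memvN inX.
  case: ifP => [sT|_]; last exact: mem0v.
  by rewrite inX // swapT // iD.
have Xst i : (0 < i < n)%N -> (hpi N i @: <<X>> <= <<X>>)%VS.
  move=> hi; rewrite limg_span; apply/span_subvP => _ /mapP[_ /mapP[T TT' ->] ->].
  exact: Xpi.
pose N' := submodule Xst.
pose f : 'Hom(N', N) := linfun (@vsval _ _ <<X>>%VS).
have fE v : f v = vsval v by exact: lfunE.
have vsN' i (u : N') : (0 < i < n)%N -> vsval (hpi N' i u) = hpi N i (vsval u).
  exact: vsval_hpi.
exists N', f, g; split.
  exists (fun T => vsproj <<X>>%VS (b T)); split.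
    have := @limg_basis_of _ _ _ (linfun (vsproj <<X>>%VS)) <<X>>%VS X.
    have -> : (linfun (vsproj <<X>>) @: <<X>>)%VS = fullv.
      apply/vspaceP => u; rewrite memvf; apply/memv_imgP.
      by exists (vsval u); rewrite ?subvsP // lfunE /= vsvalK.
    rewrite -map_comp (eq_map (fun T => lfunE _ (b T))); apply.
      apply/eqP; rewrite -subv0; apply/subvP => v; rewrite memv_cap memv_ker lfunE /= memv0.
      by case/andP=> vX /eqP vp; rewrite -(vsprojK vX) vp linear0.
    by rewrite /basis_of eqxx; have := basis_free bb0; rewrite free_cons => /andP[].
  move=> T TT' i hi; apply: subvs_inj.
  have TTT : T \in TT by move: TT'; rewrite mem_rem' => /andP[].
  rewrite vsN' // vsprojK; last by rewrite memv_span // map_f.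
  rewrite bpi //; case: ifP => iD; first by rewrite linearN /= vsprojK // memv_span // map_f.
  rewrite mem_rem' swapT ?iD //=; case: ifP => sT; last by rewrite linear0.
  by rewrite vsprojK // memv_span // map_f // mem_rem' swapT ?iD.
apply: induced_exact => //.
- by move=> i hi v; rewrite !fE vsN'.
- move=> i hi v; rewrite -[LHS]comp_lfunE -[RHS]comp_lfunE; congr (fun_of_lfun _ v).
  apply/(fullv_lfunP _ _ (span_basis bb0)) => w; rewrite inE !comp_lfunE /= line_hpiE.
  (* For [T0] itself a nonattacking ascent gives another filling, which the quotient map kills; the
     remaining basis vectors stay in the kernel. *)
  case/predU1P=> [->|wX].
    rewrite g0 bpi //; case: ifP => iD; first by rewrite linearN /= g0.
    case: ifP => [sT|_]; last by rewrite linear0.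
    apply/eqP; rewrite -memv_ker gker memv_span // map_f // mem_rem' sT andbT.
    by apply: swapT; rewrite ?iD.
  have gK u : u \in <<X>>%VS -> g u = 0 by rewrite -gker memv_ker => /eqP.
  rewrite (gK w) ?memv_span // oppr0 if_same gK //.
  by case/mapP: wX => T hT ->; apply: Xpi.
- apply/eqP/lker0P => u v; rewrite !fE; exact: subvs_inj.
- rewrite gker; apply/vspaceP => v; apply/memv_imgP/idP => [[u _ ->]|vX].
    by rewrite fE subvsP.
  by exists (vsproj <<X>>%VS v); rewrite ?memvf // fE vsprojK.
Qed.

End ChDiagram.

(** * Descent sets of compositions *)

Section DescentSets.
Local Open Scope nat_scope.
Implicit Types (al be X : seq nat) (n : nat).

Lemma foldl_addn s x : foldl addn x s = x + sumn s.
Proof. by elim: s x => [|y s IH] x /=; rewrite ?addn0 // IH addnA. Qed.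

Lemma Des_rcons be a : Des (rcons be a) = scanl addn 0 be.
Proof.
by rewrite /Des size_rcons /= scanl_rcons -cats1 take_size_cat ?size_scanl.
Qed.

Lemma rcons_Des al : al != [::] -> rcons (Des al) (sumn al) = scanl addn 0 al.
Proof.
by case/lastP: al => // be a _; rewrite Des_rcons scanl_rcons foldl_addn add0n.
Qed.

Lemma DesE al : Des al = [seq sumn (take r al) | r <- iota 1 (size al).-1].
Proof.
have sz : size (Des al) = (size al).-1.
  by rewrite size_take size_scanl; case: (size al) => //= k; rewrite ltnSn.
apply: (@eq_from_nth _ 0); first by rewrite sz size_map size_iota.
move=> i; rewrite sz => hi; rewrite nth_take // (nth_map 0) ?size_iota // nth_iota // add1n.
by rewrite nth_scanl ?foldl_addn //; move: hi; case: (size al) => // k; apply: ltnW.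
Qed.

Lemma comp_of_Des al : is_comp al -> comp_of (sumn al) (Des al) = al.
Proof.
case: (eqVneq al [::]) => [->//|al0 cal]; rewrite /comp_of rcons_Des //.
have -> : sumn al = (sumn al).-1.+1 by case: al al0 cal => // [[]].
by apply: scanlK => x y; rewrite addKn.
Qed.

Lemma Des_inj al be : is_comp al -> is_comp be -> sumn al = sumn be ->
  Des al = Des be -> al = be.
Proof. by move=> ca cb es ed; rewrite -(comp_of_Des ca) es ed comp_of_Des. Qed.

Lemma path_rcons_ltn n X : 0 < n ->
  path ltn 0 (rcons X n) = sorted ltn X && all (fun i => 0 < i < n) X.
Proof.
move=> n0; rewrite (path_pairwise ltn_trans) /= pairwise_rcons all_rcons n0.
rewrite (sorted_pairwise ltn_trans) andbA andbC; congr (_ && _).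
by rewrite -all_predI; apply: eq_all.
Qed.

Lemma path_scanl (e : rel nat) (d : nat) al x :
  (forall a b, d <= b -> e a (a + b)) -> all (leq d) al -> path e x (scanl addn x al).
Proof. by move=> he; elim: al x => //= a al IH x /andP[da dal]; rewrite he ?IH. Qed.

Lemma Des_sorted al : is_comp al ->
  sorted ltn (Des al) && all (fun i => 0 < i < sumn al) (Des al).
Proof.
case: (eqVneq al [::]) => [->//|al0 cal].
rewrite -path_rcons_ltn ?rcons_Des //; last by case: al al0 cal => // [[]].
by apply: path_scanl cal => a b b0; rewrite /= -{1}[a]addn0 ltn_add2l.
Qed.

Lemma scanl_pairmap x s : path leq x s ->
  scanl addn x (pairmap (fun a b => b - a) x s) = s.
Proof.
by elim: s x => //= y s IH x /andP[xy /IH]; rewrite subnKC // => ->.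
Qed.

Lemma sumn_pairmap x s : path leq x s ->
  x + sumn (pairmap (fun a b => b - a) x s) = last x s.
Proof.
elim: s x => /= [|y s IH] x; first by rewrite addn0.
by case/andP=> xy /IH <-; rewrite addnA subnKC.
Qed.

Lemma pairmap_all (d : nat) x s : path (fun a b => a + d <= b) x s ->
  all (leq d) (pairmap (fun a b => b - a) x s).
Proof.
by elim: s x => //= y s IH x /andP[xy /IH ->]; rewrite leq_subRL ?andbT //; lia.
Qed.

Section CompOf.
Variables (n : nat) (X : seq nat).
Hypothesis X_sorted : sorted ltn X.
Hypothesis X_range : all (fun i => 0 < i < n) X.

Lemma comp_ofE : 0 < n -> comp_of n X = pairmap (fun a b => b - a) 0 (rcons X n).
Proof. by rewrite /comp_of; case: n. Qed.

Let X_path : 0 < n -> path ltn 0 (rcons X n).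
Proof. by move=> n0; rewrite path_rcons_ltn // X_sorted X_range. Qed.

Let X_nil : n = 0 -> X = [::].
Proof. by move: X_range; case: X => // x s /=; case: n => // /andP[/andP[]]. Qed.

Let X_path_leq : 0 < n -> path leq 0 (rcons X n).
Proof. by move/X_path; apply: sub_path => a b; apply: ltnW. Qed.

Lemma comp_of_comp : is_comp (comp_of n X).
Proof.
have [n0|n0] := posnP n; first by rewrite /comp_of n0.
rewrite comp_ofE //; apply: pairmap_all; apply: sub_path (X_path n0) => a b.
by rewrite addn1.
Qed.

Lemma sumn_comp_of : sumn (comp_of n X) = n.
Proof.
have [n0|n0] := posnP n; first by rewrite /comp_of n0.
by rewrite comp_ofE // -[sumn _]add0n sumn_pairmap ?last_rcons ?X_path_leq.
Qed.

Lemma Des_comp_of : Des (comp_of n X) = X.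
Proof.
have [n0|n0] := posnP n; first by rewrite X_nil // /comp_of n0.
rewrite /Des comp_ofE // scanl_pairmap ?X_path_leq //.
by rewrite size_pairmap size_rcons /= -cats1 take_size_cat.
Qed.

Lemma comp_of_peak : path (fun a b => a + 2 <= b) 0 X -> is_peak_comp (comp_of n X).
Proof.
move=> X2; rewrite /is_peak_comp comp_of_comp /=.
have [n0|n0] := posnP n; first by rewrite /comp_of n0.
rewrite comp_ofE // -cats1 pairmap_cat /= size_cat /= addn1 /= take_size_cat //.
exact: pairmap_all.
Qed.

End CompOf.

(** Two peaks are never adjacent and 1 is never a peak. The gaps, counted from 0, are the parts
    before the last one of the associated composition, which is therefore a peak composition. *)
Lemma Peak_path X : sorted ltn X -> path (fun a b => a + 2 <= b) 0 (Peak X).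
Proof.
move=> sX.
have : path ltn 0 (Peak X).
  rewrite (path_sortedE ltn_trans) sorted_filter ?andbT //; last exact: ltn_trans.
  by apply/allP => i; rewrite mem_filter => /andP[/andP[/ltnW]].
apply: (@sub_in_path _ [in 0 :: Peak X]); last by apply/allP.
move=> a b; rewrite !inE => /orP ha /predU1P[->|]; first by [].
rewrite mem_filter => /andP[/andP[b1 bX] _] ab.
case: ha => [/eqP->//|]; rewrite mem_filter => /andP[_ aX].
by rewrite addn2 ltn_neqAle [a < b]ab andbT; apply: contra bX => /eqP <-.
Qed.

(** All parts before the last are at least 2, so the partial sums exceed 1 and no two of them are
    adjacent. *)
Lemma Peak_Des al : is_peak_comp al -> Peak (Des al) = Des al.
Proof.
case/lastP: al => // be a; rewrite /is_peak_comp size_rcons -cats1 take_size_cat //.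
rewrite cats1 Des_rcons => /andP[_ be2]; apply/all_filterP/allP => i.
set s := scanl _ _ _ => si.
have tr : transitive (fun a b => a + 2 <= b) by move=> y x z; lia.
have ps : path (fun a b => a + 2 <= b) 0 s.
  by apply: path_scanl be2 => x y; rewrite leq_add2l.
have i2 := allP (order_path_min tr ps) _ si; rewrite [1 < i]i2 /=.
apply/negP => si'; have ss := path_sorted ps.
have [h|h|h] := ltngtP (index i s) (index i.-1 s).
- by have := sorted_ltn_index tr ss _ _ si si' h; lia.
- by have := sorted_ltn_index tr ss _ _ si' si h; lia.
- by have := nth_index 0 si; rewrite h nth_index //; lia.
Qed.

Definition mu n X := \sum_(p <- X) (n - p).

(* In the order given by the weight [mu] on descent sets both the expansion
   of the peak functions into monomials and that of the peak Young
   quasisymmetric Schur functions into peak functions are triangular; in each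
   case [phi] moves the elements of the descent set downwards. *)
Lemma mu_lt_or_eq n Q D (phi : nat -> nat) :
    sorted ltn Q -> sorted ltn D -> {in Q &, injective phi} ->
    {in Q, forall q, phi q \in D} -> {in Q, forall q, phi q <= q} ->
    {in Q, forall q, q < n} -> {in D, forall p, p < n} ->
  mu n Q < mu n D \/ Q = D.
Proof.
move=> sQ sD inj QD le Qn Dn.
have uQ : uniq Q := sorted_uniq ltn_trans ltnn sQ.
have uD : uniq D := sorted_uniq ltn_trans ltnn sD.
pose s := [seq phi q | q <- Q].
have us : uniq s by rewrite map_inj_in_uniq.
have sD' : {subset s <= D} by move=> _ /mapP[q qQ ->]; apply: QD.
(* The elements of D missed by [phi]; each of them contributes a positive amount to the weight of
   D. *)
pose r := [seq p <- D | p \notin s].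
have muD : mu n D = \sum_(q <- Q) (n - phi q) + mu n r.
  have -> : \sum_(q <- Q) (n - phi q) = \sum_(p <- s) (n - p) by rewrite big_map.
  rewrite /mu -big_cat; apply: perm_big.
  rewrite -(perm_filterC [in s] D) perm_cat //.
  apply: uniq_perm; rewrite ?filter_uniq // => p; rewrite mem_filter.
  by apply/andP/idP => [[]//|ps]; split=> //; apply: sD'.
have le_s : mu n Q <= \sum_(q <- Q) (n - phi q).
  rewrite /mu big_seq [leqRHS]big_seq; apply: leq_sum => q qQ.
  by have := le q qQ; lia.
have [r0|r0] := boolP (nilp r); last first.
  have [p pr] : exists p, p \in r by case: (r) r0 => // p *; exists p; apply: mem_head.
  left; rewrite muD (leq_ltn_trans le_s) // -[ltnLHS]addn0 ltn_add2l.
  rewrite /mu (big_rem p) //=; have : p \in D by move: pr; rewrite mem_filter => /andP[].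
  by move/Dn; lia.
(* Now [phi] is onto D. Either it is the identity and Q = D, or it moves some q strictly down, which
   makes n - q strictly larger. *)
have [/allP/= fixQ|/allPn[q qQ nq]] := boolP (all (fun q => phi q == q) Q).
  right; apply: (irr_sorted_eq ltn_trans ltnn) => // p.
  have sQe : s = Q by rewrite -[RHS]map_id; apply/eq_in_map => q /fixQ /eqP.
  apply/idP/idP => [pQ|pD]; first by rewrite sD' // sQe.
  rewrite -sQe; apply: contraLR r0 => ps.
  have : p \in r by rewrite mem_filter ps.
  by case: (r).
left; rewrite muD (@leq_trans (\sum_(q <- Q) (n - phi q))) ?leq_addr //.
rewrite /mu !(big_rem q qQ) /= -addSn leq_add //.
  by have := le q qQ; have := Qn q qQ; move: nq; lia.
rewrite big_seq [leqRHS]big_seq; apply: leq_sum => p /mem_rem pQ.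
by have := le p pQ; lia.
Qed.

End DescentSets.

(** * Monomial coefficients of the peak functions *)

Section MonomialCoefficients.
Variable R : realType.
Implicit Types al be P : seq nat.

(* The exponent sequence of the monomial whose word is [word P] is P. *)
Definition word P : seq nat :=
  [seq (count (leq^~ i) (Des P)).+1 | i <- iota 0 (sumn P)].

Definition monomial P : multiset nat := seq_mset (word P).

Local Open Scope nat_scope.

Lemma size_word P : size (word P) = sumn P.
Proof. by rewrite size_map size_iota. Qed.

Lemma word_sorted P : sorted leq (word P).
Proof.
apply: (homo_sorted (e := leq)); last exact: iota_sorted.
by move=> i j ij; rewrite ltnS; apply: sub_count => d /=; move/leq_trans; apply.
Qed.

Lemma nth_word P j : is_comp P -> 0 < j < sumn P ->
  (nth 0 (word P) j.-1 < nth 0 (word P) j) = (j \in Des P).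
Proof.
move=> cP /andP[j0 jn].
have /andP[sD _] := Des_sorted cP.
have uD : uniq (Des P) := sorted_uniq ltn_trans ltnn sD.
rewrite !(nth_map 0) ?size_iota ?nth_iota ?add0n //; try lia.
have -> : count (leq^~ j) (Des P) = count (leq^~ j.-1) (Des P) + count_mem j (Des P).
  rewrite -[LHS]addn0 -(count_predUI (leq^~ j.-1)) /=.
  have -> : count (predI (leq^~ j.-1) (pred1 j)) (Des P) = 0.
    by apply/eqP; rewrite -leqn0 leqNgt -has_count; apply/hasPn => d _ /=; lia.
  by congr (_ + 0); apply: eq_count => d /=; lia.
by rewrite count_uniq_mem // ltnS -[ltnLHS]addn0 ltn_add2l lt0b.
Qed.

(** The only weakly increasing rearrangement of the monomial is [word P], which rises strictly
    exactly at the descents of P. *)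
Lemma F_fun_monomial be P : is_comp be -> is_comp P ->
    F_fun R be (monomial P) <> 0%R ->
  sumn be = sumn P /\ {subset Des be <= Des P}.
Proof.
move=> cb cP; rewrite /F_fun; set c := count _ _; case: (posnP c) => [->//|+ _].
rewrite -has_count => /hasP[w]; rewrite mem_permutations => pw.
have {}pw : perm_eq w (word P) := perm_trans pw (perm_eq_seq_mset _).
case/and4P => _ /eqP sw lw /allP wD.
have ew : w = word P := sorted_eq leq_trans anti_leq lw (word_sorted P) pw.
have es : sumn be = sumn P by rewrite -sw ew size_word.
split=> // j jD; have /andP[_ /allP /(_ j jD)] := Des_sorted cb.
by rewrite es => hj; rewrite -nth_word // -ew wD.
Qed.

Lemma F_fun_monomial_diag P : is_comp P -> F_fun R P (monomial P) <> 0%R.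
Proof.
move=> cP; apply/eqP; rewrite pnatr_eq0 -lt0n -has_count.
apply/hasP; exists (word P); first by rewrite mem_permutations perm_sym perm_eq_seq_mset.
apply/and4P; split.
- by apply/allP => _ /mapP[i _ ->].
- by rewrite size_word.
- exact: word_sorted.
- apply/allP => j jD; rewrite nth_word //.
  by have /andP[_ /allP /(_ j jD)] := Des_sorted cP.
Qed.

(** Written as a natural number, the coefficient admits no cancellation: it is positive as soon as
    one summand is. *)
Lemma K_fun_coef al m : al != [::] -> K_fun R al m =
  (2 ^ (size (Peak (Des al))).+1 * \sum_(be <- compositions (sumn al)
     | all (in_symdiff_shift (Des be)) (Peak (Des al)))
      count (F_term be) (permutations m))%:R%R.
Proof.
case: al => // a al _.
by rewrite /K_fun scalrfctE fct_sumE natrM natrX natr_sum.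
Qed.

(** Some F_be in the sum contains the monomial, so Des(be) lies in Des(P); and every q in Des(al),
    being a peak, has q or q - 1 in Des(be). *)
Lemma K_fun_monomial al P : is_peak_comp al -> is_peak_comp P ->
    K_fun R al (monomial P) <> 0%R ->
  sumn al = sumn P /\ (mu (sumn P) (Des al) < mu (sumn P) (Des P) \/ al = P).
Proof.
move=> pal pP; have cal : is_comp al by case/andP: pal.
have cP : is_comp P by case/andP: pP.
case: (eqVneq al [::]) => [al0|al0].
  rewrite al0 => /F_fun_monomial - [] // e _.
  by split=> //; right; case: P cP e {pP} => // [[]].
rewrite K_fun_coef // => h.
have [be] : exists be, [/\ be \in compositions (sumn al),
    all (in_symdiff_shift (Des be)) (Peak (Des al)) & F_fun R be (monomial P) <> 0%R].
  apply: contrapT => nex; apply: h; rewrite big_seq_cond big1 ?muln0 // => be /andP[h1 h2].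
  apply/eqP; rewrite -(eqr_nat R[i]); apply/negPn/negP => h3; apply: nex.
  by exists be; split=> //; apply/eqP.
rewrite mem_compositions Peak_Des // => -[/andP[cb /eqP sb] /allP hb].
move=> /F_fun_monomial - [] // es sub; have e : sumn al = sumn P by rewrite -sb.
split=> //.
have /andP[sQ /allP rQ] := Des_sorted cal; have /andP[sD /allP rD] := Des_sorted cP.
(* This map is injective because Des(al) has no two adjacent elements. *)
pose phi q := if q \in Des P then q else q.-1.
have [] := @mu_lt_or_eq (sumn P) (Des al) (Des P) phi sQ sD.
- move=> q1 q2 q1Q q2Q /eqP; apply: contraTeq => ne; rewrite /phi.
  move: q1Q q2Q; rewrite -(Peak_Des pal) !mem_filter.
  move=> /andP[/andP[q1_gt1 n1] q1D] /andP[/andP[q2_gt1 n2] q2D].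
  have ne1 : q1.-1 != q2 by apply: contra n1 => /eqP ->.
  have ne2 : q2.-1 != q1 by apply: contra n2 => /eqP ->.
  case: (q1 \in Des P); case: (q2 \in Des P).
  + exact: ne.
  + by rewrite eq_sym; apply: ne2.
  + exact: ne1.
  + by rewrite -eqSS !prednK // ltnW.
- move=> q qQ; rewrite /phi; case: ifP => // qD.
  have := hb q qQ; rewrite /in_symdiff_shift.
  have -> : (q \in Des be) = false by apply: contraFF qD; apply: sub.
  by case/mapP=> p pD ->; apply: sub.
- by move=> q _; rewrite /phi; case: ifP => // _; apply: leq_pred.
- by move=> q /rQ; rewrite e => /andP[].
- by move=> q /rD => /andP[].
- by left.
- by move/(Des_inj cal cP e); right.
Qed.

(** The summand F_P occurs, since a peak i of P has i in Des(P) and i - 1 outside it. *)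
Lemma K_fun_monomial_diag P : is_peak_comp P -> K_fun R P (monomial P) <> 0%R.
Proof.
move=> pP; have cP : is_comp P by case/andP: pP.
case: (eqVneq P [::]) => [->|P0]; first exact: F_fun_monomial_diag.
rewrite K_fun_coef //; apply/eqP; rewrite pnatr_eq0 muln_eq0 expn_eq0 /= -lt0n.
rewrite (big_rem P) ?mem_compositions ?cP ?eqxx //=.
have -> : all (in_symdiff_shift (Des P)) (Peak (Des P)).
  apply/allP => i; rewrite mem_filter => /andP[/andP[i1 niP] iP].
  rewrite /in_symdiff_shift iP /=; apply: contra niP => /mapP[p pP' ->].
  exact: pP'.
rewrite ltn_addr // lt0n; apply/eqP => e0.
by apply: (F_fun_monomial_diag cP); rewrite /F_fun e0.
Qed.

End MonomialCoefficients.

(** * Standard peak Young composition tableaux *)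

Section Boxes.
Local Open Scope nat_scope.
Implicit Types (al be T : seq nat) (b : nat * nat).

Lemma leq_nth_sumn al i : nth 0 al i <= sumn al.
Proof. by elim: al i => [|a al IH] [|i] //=; rewrite ?leq_addr // (leq_trans (IH i)) ?leq_addl. Qed.

Lemma sumn_takeS al r : sumn (take r.+1 al) = sumn (take r al) + nth 0 al r.
Proof. by elim: al r => [|a al IH] [|r] //=; rewrite ?take0 ?IH /= ?addn0 ?addnA. Qed.

Lemma leq_sumn_take al r s : r <= s -> sumn (take r al) <= sumn (take s al).
Proof.
move=> rs; rewrite -(subnKC rs); elim: (s - r) => [|k IH]; first by rewrite addn0.
by rewrite addnS sumn_takeS; lia.
Qed.

Lemma sumn_take_all al r : size al <= r -> sumn (take r al) = sumn al.
Proof. by move=> h; rewrite take_oversize. Qed.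

Lemma comp_nth al i : is_comp al -> (0 < nth 0 al i) = (i < size al).
Proof.
move=> /(all_nthP 0) h; case: (ltnP i (size al)) => hi; first exact: h.
by rewrite nth_default.
Qed.

Lemma mem_boxes al c r : is_comp al ->
  ((c, r) \in boxes al) = [&& 0 < r, 0 < c & c <= nth 0 al r.-1].
Proof.
move=> cal; have h i := comp_nth i cal; have h' i := leq_nth_sumn al i.
rewrite mem_cat; apply/orP/and3P => [[/mapP[r' + [-> ->]]|/allpairsPdep[c' [r' [+ + [-> ->]]]]]|].
- rewrite mem_rev mem_iota => hr; have := h r'.-1; split=> //; lia.
- rewrite mem_iota mem_filter mem_iota => hc hr; split; lia.
move=> [r0 c0 cr]; have := h r.-1; have := h' r.-1 => hn hs.
have [c1|c1] := eqVneq c 1.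
  left; apply/mapP; exists r; last by rewrite c1.
  by rewrite mem_rev mem_iota; lia.
right; apply/allpairsPdep; exists c, r; rewrite mem_filter !mem_iota; split=> //; lia.
Qed.

Lemma boxes_uniq al : uniq (boxes al).
Proof.
rewrite cat_uniq; apply/and3P; split.
- by rewrite map_inj_uniq ?rev_uniq ?iota_uniq // => x y [].
- apply/hasPn => _ /allpairsPdep[c [r [+ _ ->]]]; rewrite mem_iota => c2.
  by apply/mapP => -[r' _ [e _]]; move: c2; rewrite e.
- apply: allpairs_uniq_dep; rewrite ?iota_uniq //.
    by move=> c _; rewrite filter_uniq ?iota_uniq.
  by move=> [c r] [c' r'] _ _ /= [-> ->].
Qed.

Lemma boxes_sorted al : sorted (fun b b' => b.1 <= b'.1) (boxes al).
Proof.
have tr : transitive (fun b b' : nat * nat => b.1 <= b'.1).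
  by move=> y x z; apply: leq_trans.
rewrite sorted_pairwise // pairwise_cat; apply/and3P; split.
- apply/allrelP => _ _ /mapP[r _ ->] /allpairsPdep[c [r' [+ _ ->]]].
  by rewrite mem_iota /=; lia.
- by rewrite pairwise_map; apply/(pairwiseP 0) => i j _ _ _ /=.
elim: (_.-1) {1}2 => [|k IH] m //=.
rewrite pairwise_cat IH andbT; apply/andP; split; last first.
  by rewrite pairwise_map; apply/(pairwiseP 0) => i j _ _ _ /=.
apply/allrelP => _ _ /mapP[r _ ->] /allpairsPdep[c [r' [+ _ ->]]].
by rewrite mem_iota /=; lia.
Qed.

Lemma index_box_col al b b' : b \in boxes al -> b' \in boxes al -> b.1 < b'.1 ->
  index b (boxes al) < index b' (boxes al).
Proof.
move=> hb hb' lt; rewrite ltnNge leq_eqVlt; apply/negP => /orP[/eqP e|].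
  by have := nth_index b hb; rewrite -e nth_index // => e'; rewrite e' ltnn in lt.
have tr : transitive (fun b b' : nat * nat => b.1 <= b'.1).
  by move=> y x z; apply: leq_trans.
by move=> h; have := sorted_ltn_index tr (boxes_sorted al) _ _ hb' hb h; rewrite leqNgt lt.
Qed.

Definition row_boxes al : seq (nat * nat) :=
  [seq (c, r.+1) | r <- iota 0 (size al), c <- iota 1 (nth 0 al r)].

Lemma perm_boxes al : is_comp al -> perm_eq (boxes al) (row_boxes al).
Proof.
move=> cal; apply: uniq_perm; first exact: boxes_uniq.
  apply: allpairs_uniq_dep; rewrite ?iota_uniq //.
    by move=> r _; rewrite iota_uniq.
  by move=> [r c] [r' c'] _ _ /= [-> ->].
move=> [c r]; rewrite mem_boxes //.
apply/and3P/allpairsPdep => [[r0 c0 cr]|[r' [c' [+ + [-> ->]]]]].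
  exists r.-1, c; rewrite !mem_iota add1n ltnS c0 cr prednK //.
  by have := comp_nth r.-1 cal; split=> //; lia.
by rewrite !mem_iota => ? ?; split=> //=; lia.
Qed.

(** The entry of b when the boxes are numbered row by row from the bottom. *)
Definition row_entry al b := sumn (take b.2.-1 al) + b.1.

Lemma row_entry_iota al : [seq row_entry al b | b <- row_boxes al] = iota 1 (sumn al).
Proof.
(* For the induction on [al], the offset counts the boxes of the rows already removed. *)
suff h off : [seq off + row_entry al b | b <- row_boxes al] = iota off.+1 (sumn al).
  by rewrite -h; apply: eq_map => b; rewrite add0n.
rewrite /row_boxes /row_entry; elim: al off => //= a al IH off.
rewrite iotaD map_cat -map_comp; congr (_ ++ _).
  by rewrite -[off.+1]addn1 [LHS](_ : _ = [seq off + c | c <- iota 1 a]) ?iotaDl.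
rewrite (iotaDl 1 0) -[RHS]/(iota (off + a).+1 _) -IH.
rewrite /allpairs_dep -map_comp !map_flatten -!map_comp; congr flatten.
apply: eq_map => r /=; rewrite -!map_comp; apply: eq_map => c /=.
by rewrite !addnA.
Qed.

Lemma size_boxes al : is_comp al -> size (boxes al) = sumn al.
Proof.
move=> cal; rewrite (perm_size (perm_boxes cal)) -(size_map (row_entry al)).
by rewrite row_entry_iota size_iota.
Qed.

Section Filling.
Variables (al T : seq nat).
Hypotheses (cal : is_comp al) (Tp : perm_eq T (iota 1 (sumn al))).

Lemma size_filling : size T = size (boxes al).
Proof. by rewrite size_boxes // (perm_size Tp) size_iota. Qed.

Lemma filling_uniq : uniq T.
Proof. by rewrite (perm_uniq Tp) iota_uniq. Qed.

Lemma mem_entry b : b \in boxes al -> 0 < entry al T b <= sumn al.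
Proof.
by move=> hb; rewrite -(perm_iota_mem _ Tp) mem_nth // size_filling index_mem.
Qed.

Lemma index_entry b : b \in boxes al -> index (entry al T b) T = index b (boxes al).
Proof. by move=> hb; rewrite index_uniq ?filling_uniq // size_filling index_mem. Qed.

Lemma entry_inj : {in boxes al &, injective (entry al T)}.
Proof.
move=> b b' hb hb' e; have := index_entry hb; rewrite e index_entry // => ei.
by rewrite -(nth_index b hb) -ei nth_index.
Qed.

Lemma entry_onto i : 0 < i <= sumn al -> exists2 b, b \in boxes al & entry al T b = i.
Proof.
rewrite -(perm_iota_mem _ Tp) => iT; exists (nth (0, 0) (boxes al) (index i T)).
  by rewrite mem_nth // -size_filling index_mem.
by rewrite /entry index_uniq ?boxes_uniq ?nth_index // -size_filling index_mem.
Qed.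

Lemma DesT_entry b b' : b \in boxes al -> b' \in boxes al ->
    entry al T b' = (entry al T b).+1 -> b'.1 < b.1 -> entry al T b \in DesT T.
Proof.
move=> hb hb' e lt; rewrite (mem_DesT _ Tp) -e !index_entry // index_box_col // andbT.
by have := mem_entry hb; have := mem_entry hb'; lia.
Qed.

Lemma not_DesT_entry b b' : b \in boxes al -> b' \in boxes al ->
    entry al T b' = (entry al T b).+1 -> b.1 < b'.1 -> entry al T b \notin DesT T.
Proof.
move=> hb hb' e lt; rewrite (mem_DesT _ Tp) -e !index_entry //.
by rewrite negb_and -leqNgt (ltnW (index_box_col hb hb' lt)) orbT.
Qed.

End Filling.
End Boxes.

(** * Peaks between consecutive entries of the first column *)

Section Peaks.
Local Open Scope nat_scope.
Implicit Types (al be T : seq nat) (b : nat * nat).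

Lemma peak_comp_nth al r : is_peak_comp al -> r.+1 < size al -> 2 <= nth 0 al r.
Proof.
move=> /andP[_ /(all_nthP 0) h] hr; have := h r; rewrite nth_take; last by lia.
by apply; rewrite size_take; case: ifP; lia.
Qed.

Lemma leq_sumn_nth s t r : size s <= r ->
  (forall j, j < size s -> nth 0 s j <= nth 0 t j) -> sumn s <= sumn (take r t).
Proof.
elim: s t r => [|x s IH] t r //= sr h; case: r sr => // r sr.
have x0 := h 0 isT; have {}IH := IH (behead t) r sr.
have : sumn s <= sumn (take r (behead t)).
  by apply: IH => j js; have := h j.+1 js; rewrite nth_behead.
by case: t x0 {h IH} => [|y t] /=; rewrite ?take_nil /=; lia.
Qed.

Section PeakOfTableau.
Variables (al T : seq nat).
Hypotheses (pal : is_peak_comp al) (hT : is_SPYCT al T).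
Let cal : is_comp al. Proof. by case/andP: pal. Qed.
Let hS : is_SYCT al T. Proof. by case/andP: hT. Qed.
Let Tp : perm_eq T (iota 1 (sumn al)). Proof. by case/and4P: hS. Qed.
Let n := sumn al.
Let t := entry al T.
Let D := boxes al.

Lemma SYCT_row c r : (c, r) \in D -> (c.+1, r) \in D -> t (c, r) < t (c.+1, r).
Proof. by case/and4P: hS => _ /allP h _ _ h1 h2; have := h _ h1; rewrite /= h2. Qed.

Lemma SYCT_col r : (1, r) \in D -> (1, r.+1) \in D -> t (1, r) < t (1, r.+1).
Proof. by case/and4P: hS => _ _ /allP h _ h1 h2; have := h _ h1; rewrite /= h2. Qed.

Lemma col1_box r : ((1, r) \in D) = (0 < r <= size al).
Proof.
by rewrite mem_boxes //; have := comp_nth r.-1 cal; lia.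
Qed.

Lemma SYCT_col_lt r s : 0 < r -> r < s -> s <= size al -> t (1, r) < t (1, s).
Proof.
move=> r0; elim: s => // s IH; rewrite ltnS leq_eqVlt => /predU1P[<-|rs] sl.
  by apply: SYCT_col; rewrite col1_box; lia.
apply: ltn_trans (IH rs _) _; first exact: ltnW.
by apply: SYCT_col; rewrite col1_box; lia.
Qed.

Lemma SPYCT_subshape k : 0 < k <= n -> exists2 be, is_peak_comp be /\ sumn be = k &
  forall b, (b \in boxes be) = (t b <= k) && (b \in D).
Proof.
move=> hk; case/andP: hT => _ /allP /(_ k).
rewrite mem_iota add1n ltnS => /(_ hk) /hasP[be].
rewrite mem_compositions => /andP[_ /eqP sb] /andP[pb pD].
by exists be => // b; rewrite -(perm_mem pD) mem_filter.
Qed.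

Section Row.
Variable r : nat.
Hypothesis r0 : 0 < r.
Hypothesis rl : r < size al.

Let a_box : (1, r) \in D. Proof. by rewrite col1_box; lia. Qed.
Let a'_box : (1, r.+1) \in D. Proof. by rewrite col1_box; lia. Qed.

(** The entries up to that of (1, r + 1) form a peak composition diagram with more than r rows, so
    its row r already has two boxes. *)
Lemma row_second : (2, r) \in D /\ t (1, r) < t (2, r) < t (1, r.+1).
Proof.
have [be [pb sb] hb] := SPYCT_subshape (mem_entry cal Tp a'_box).
have cb : is_comp be by case/andP: pb.
have : (1, r.+1) \in boxes be by rewrite hb leqnn a'_box.
rewrite mem_boxes //= comp_nth // => rb.
have : (2, r) \in boxes be.
  by rewrite mem_boxes // r0 /=; apply: peak_comp_nth => //; lia.
rewrite hb => /andP[le hD]; split=> //; rewrite SYCT_row //= ltn_neqAle.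
rewrite le andbT; apply/eqP => /(entry_inj cal Tp hD a'_box) [] /esym; lia.
Qed.

(** The smaller entries form a diagram inside that of [al] without the box (1, r + 1), hence with at
    most r rows. *)
Lemma leq_pred_sumn_take : (t (1, r.+1)).-1 <= sumn (take r al).
Proof.
have [_ /andP[h1 h2]] := row_second.
have hk : 0 < (t (1, r.+1)).-1 <= n.
  by have := mem_entry cal Tp a'_box; rewrite -/t -/n; lia.
have [be [pb sb] hb] := SPYCT_subshape hk.
have cb : is_comp be by case/andP: pb.
rewrite -[leqLHS]sb; apply: leq_sumn_nth.
  have : (1, r.+1) \notin boxes be by rewrite hb; lia.
  by rewrite mem_boxes //= comp_nth // -leqNgt.
move=> j jb; have : (nth 0 be j, j.+1) \in boxes be by rewrite mem_boxes //= comp_nth // jb leqnn.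
by rewrite hb => /andP[_]; rewrite mem_boxes // => /and3P[].
Qed.

(** The first column increases upwards, so it has no entry strictly between two consecutive ones. *)
Lemma row_inner_box i b : b \in D -> t b = i -> t (1, r) < i < t (1, r.+1) -> 1 < b.1.
Proof.
case: b => c s hb <- /andP[h1 h2]; have := hb; rewrite mem_boxes //= => /and3P[s0 c0 _].
rewrite ltn_neqAle c0 andbT; apply/eqP => c1; subst c; move: hb; rewrite col1_box => sl.
have [rs|sr|e] := ltngtP r s; last by rewrite e ltnn in h1.
  have [rs1|//|e] := ltngtP r.+1 s; last by rewrite e ltnn in h2.
    by have := @SYCT_col_lt r.+1 s; rewrite -/t; lia.
  lia.
by have := @SYCT_col_lt s r; rewrite -/t; lia.
Qed.

Lemma row_peak : exists2 p, p \in Peak (DesT T) &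
  (t (1, r) < p < t (1, r.+1)) && (p <= sumn (take r al)).
Proof.
have [hD2 /andP[h1 h2]] := row_second; have hle := leq_pred_sumn_take.
have ra := mem_entry cal Tp a_box; have ra' := mem_entry cal Tp a'_box.
rewrite -/t -/n in ra ra'.
(* The next entry is still below that of (1, r + 1), so it lies in a later column and is read
   later. *)
have aD : t (1, r) \notin DesT T.
  have [|b hb eb] := @entry_onto al T cal Tp (t (1, r)).+1; first by rewrite -/n; lia.
  apply: (not_DesT_entry cal Tp a_box hb eb).
  by apply: row_inner_box hb eb _; lia.
(* This entry lies outside the first column and is read after its successor, which lies in that
   column. *)
have a'D : (t (1, r.+1)).-1 \in DesT T.
  have [|b hb eb] := @entry_onto al T cal Tp (t (1, r.+1)).-1; first by rewrite -/n; lia.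
  rewrite -eb; apply: (DesT_entry cal Tp hb a'_box); first by rewrite eb prednK //; lia.
  by apply: row_inner_box hb eb _; lia.
have ex : exists i, (i \in DesT T) && (t (1, r) < i).
  by exists (t (1, r.+1)).-1; rewrite a'D; lia.
(* The first descent after the non-descent t(1, r) is a peak. *)
case: (ex_minnP ex) => p /andP[pD ap] pmin.
have pa' : p <= (t (1, r.+1)).-1 by apply: pmin; rewrite a'D; lia.
exists p; last by lia.
rewrite mem_filter pD andbT; apply/andP; split; first by lia.
apply/negP => p1D; have [e|ne] := eqVneq p.-1 (t (1, r)); first by rewrite -e p1D in aD.
have := pmin p.-1; rewrite p1D; lia.
Qed.

End Row.

Lemma mu_Peak_SPYCT : mu n (Des al) < mu n (Peak (DesT T)) \/ Des al = Peak (DesT T).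
Proof.
have /andP[sD /allP rD] := Des_sorted cal.
(* The number r of the row with q = al_1 + ... + al_r; the successor turns the index from 0 into a
   row number. *)
pose rk q := (index q (Des al)).+1.
have rkP q : q \in Des al -> (0 < rk q < size al) /\ q = sumn (take (rk q) al).
  move=> qD; have hi : index q (Des al) < (size al).-1.
    by move: qD; rewrite -index_mem {2}DesE size_map size_iota.
  split; first by rewrite /rk; lia.
  rewrite -[LHS](nth_index 0 qD) {1}DesE (nth_map 0) ?size_iota //.
  by rewrite nth_iota // add1n.
pose P q p := (t (1, rk q) < p < t (1, (rk q).+1)) && (p <= q).
(* One of the peaks supplied by [row_peak]; the list is nonempty for q in Des(al), so the default 0
   is not reached there. *)
pose phi q := head 0 [seq p <- Peak (DesT T) | P q p].
have phiP q : q \in Des al -> phi q \in Peak (DesT T) /\ P q (phi q).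
  move=> /rkP[/andP[k0 kl] eq].
  have [p pD hp] := row_peak k0 kl; rewrite -eq in hp.
  have : p \in [seq p <- Peak (DesT T) | P q p] by rewrite mem_filter pD andbT.
  move=> hin; have : phi q \in [seq p <- Peak (DesT T) | P q p].
    by rewrite /phi; case: [seq p <- _ | _] hin => // x s _; apply: mem_head.
  by rewrite mem_filter => /andP[].
apply: (@mu_lt_or_eq n (Des al) (Peak (DesT T)) phi) => //.
- by apply: (sorted_filter ltn_trans); apply: DesT_sorted.
(* The intervals between consecutive first column entries are disjoint and ordered by row, which
   gives injectivity. *)
- have aux q1 q2 : q1 \in Des al -> q2 \in Des al -> rk q1 < rk q2 -> phi q1 < phi q2.
    move=> h1 h2 lt; have [_ /andP[/andP[_ l1] _]] := phiP _ h1.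
    have [_ /andP[/andP[l2 _] _]] := phiP _ h2.
    apply: leq_trans l1 _; apply: leq_trans _ (ltnW l2).
    have [/andP[k0 kl] _] := rkP _ h2.
    move: lt; rewrite leq_eqVlt => /predU1P[->//|lt].
    by apply: ltnW; apply: SYCT_col_lt => //; lia.
  move=> q1 q2 h1 h2 e; have [lt|lt|er] := ltngtP (rk q1) (rk q2).
  + by have := aux _ _ h1 h2 lt; rewrite e ltnn.
  + by have := aux _ _ h2 h1 lt; rewrite e ltnn.
  + by have [_ ->] := rkP _ h1; have [_ ->] := rkP _ h2; rewrite er.
- by move=> q /phiP[].
- by move=> q /phiP[_ /andP[]].
- by move=> q /rD /andP[].
- move=> p; rewrite mem_filter => /andP[_]; rewrite (mem_DesT _ Tp) => /andP[/andP[]] //.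
Qed.

End PeakOfTableau.
End Peaks.

(** * The tableau filled row by row *)

Section RowTableau.
Local Open Scope nat_scope.
Implicit Types (al be : seq nat) (b : nat * nat).

(** The shape of the first k boxes in the row by row numbering: full rows, then at most one partial
    row. *)
Fixpoint trunc al k : seq nat :=
  if al is a :: al' then if k == 0 then [::] else minn a k :: trunc al' (k - a)
  else [::].

Lemma nth_trunc al k j : nth 0 (trunc al k) j = minn (nth 0 al j) (k - sumn (take j al)).
Proof.
elim: al k j => [|a al IH] k j /=; first by rewrite nth_nil min0n.
case: eqP => [->|_]; first by rewrite nth_nil sub0n minn0.
by case: j => [|j] /=; rewrite ?subn0 // IH subnDA.
Qed.

Lemma sumn_trunc al k : k <= sumn al -> sumn (trunc al k) = k.
Proof.
elim: al k => [|a al IH] k /=; first by rewrite leqn0 => /eqP.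
by case: eqP => [->//|_] /= h; rewrite IH; lia.
Qed.

Lemma is_peak_comp_cons a al :
  is_peak_comp (a :: al) = [&& 0 < a, nilp al || (2 <= a) & is_peak_comp al].
Proof.
rewrite /is_peak_comp /=; case: al => [|b al] /=; first by rewrite !andbT.
by case: (ltnP 0 a) (ltnP 1 a) => h [] h' //=; rewrite ?andbF //; lia.
Qed.

Lemma trunc_peak_comp al k : is_peak_comp al -> is_peak_comp (trunc al k).
Proof.
elim: al k => [|a al IH] k //; rewrite is_peak_comp_cons => /and3P[a0 a2 pal] /=.
case: eqP => // k0; rewrite is_peak_comp_cons IH // andbT; apply/andP; split; first by lia.
case: al a2 {IH pal} => //= b al a2.
(* A further row is begun only if k exceeds a, and then the present part is a itself, which is at
   least 2. *)
by case: eqP => //= h; lia.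
Qed.

Definition row_tableau al : seq nat := [seq row_entry al b | b <- boxes al].

Variable al : seq nat.
Hypothesis pal : is_peak_comp al.
Let cal : is_comp al. Proof. by case/andP: pal. Qed.
Let T := row_tableau al.

Lemma row_tableau_perm : perm_eq T (iota 1 (sumn al)).
Proof. by rewrite -row_entry_iota perm_map // perm_boxes. Qed.

Lemma entry_row_tableau b : b \in boxes al -> entry al T b = row_entry al b.
Proof. by move=> hb; rewrite /entry (nth_map (0, 0)) ?index_mem // nth_index. Qed.

Lemma row_entry_le b : b \in boxes al -> row_entry al b <= sumn (take b.2 al).
Proof.
case: b => c [|r]; rewrite mem_boxes //= => /andP[_ cr].
by rewrite sumn_takeS leq_add2l.
Qed.

Lemma row_tableau_SYCT : is_SYCT al T.
Proof.
apply/and4P; split; first exact: row_tableau_perm.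
- apply/allP => -[c r] hb; apply/implyP => hb'.
  by rewrite !entry_row_tableau // ltn_add2l.
- apply/allP => -[c r] hb; apply/implyP => /andP[/eqP c1 hb']; subst c.
  rewrite !entry_row_tableau //; apply: leq_ltn_trans (row_entry_le hb) _.
  by rewrite /row_entry /= addn1.
- apply/allP => -[c r] hb; apply/allP => r' _; apply/implyP => /and3P[rr' hb'].
  (* The triple condition is vacuous: a lower row has smaller entries throughout. *)
  rewrite (entry_row_tableau hb) (entry_row_tableau hb') => lt; exfalso.
  move: lt; apply/negP; rewrite -leqNgt.
  apply: leq_trans (row_entry_le hb') _.
  apply: leq_trans (leq_addr c _); apply: leq_sumn_take; rewrite /=.
  by move: rr'; case: (r) => // k; rewrite ltnS.
Qed.

Lemma row_tableau_SPYCT : T \in SPYCT al.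
Proof.
rewrite mem_filter mem_permutations row_tableau_perm andbT /is_SPYCT row_tableau_SYCT.
apply/allP => k; rewrite mem_iota add1n ltnS => /andP[k0 kn].
have pk := trunc_peak_comp k pal; have ck : is_comp (trunc al k) by case/andP: pk.
apply/hasP; exists (trunc al k); first by rewrite mem_compositions ck sumn_trunc //=.
rewrite pk; apply: uniq_perm; rewrite ?filter_uniq ?boxes_uniq // => -[c r].
rewrite mem_filter andbC; have [hb|] := boolP ((c, r) \in boxes al).
  rewrite entry_row_tableau // mem_boxes // nth_trunc /row_entry /=.
  move: hb; rewrite mem_boxes // => /and3P[r0 c0 h]; rewrite r0 c0 /=; lia.
rewrite !mem_boxes // nth_trunc; case: (0 < r) => //; case: (0 < c) => //=; lia.
Qed.

(** Inside a row i + 1 is one column to the right of i. At the end of a row below the top it starts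
    the next row, an earlier column because the row of i has at least two boxes. *)
Lemma DesT_row_tableau : DesT T = Des al.
Proof.
have /andP[sD /allP rD] := Des_sorted cal.
apply: (irr_sorted_eq ltn_trans ltnn) => //; first exact: DesT_sorted.
move=> i; have [hi|hi] := boolP (0 < i < sumn al); last first.
  rewrite (mem_DesT _ row_tableau_perm) (negPf hi); apply/esym/negP => /rD.
  by rewrite (negPf hi).
have [|[c r] hb] := @entry_onto al T cal row_tableau_perm i; first by lia.
move=> ei; have := ei; rewrite entry_row_tableau // /row_entry /= => ei'.
have := hb; rewrite mem_boxes // => /and3P[r0 c0]; rewrite leq_eqVlt => /predU1P[ec|lt].
- have ei2 : i = sumn (take r al).
    by rewrite -ei' ec -sumn_takeS prednK.
  have rl : r < size al.
    rewrite ltnNge; apply/negP => h; move: hi; rewrite ei2 sumn_take_all // ltnn andbF //.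
  have hb' : (1, r.+1) \in boxes al by rewrite mem_boxes //= comp_nth.
  have -> : i \in Des al.
    by rewrite DesE; apply/mapP; exists r => //; rewrite mem_iota; lia.
  rewrite -ei; apply: (DesT_entry cal row_tableau_perm hb hb').
    by rewrite ei ei2 entry_row_tableau // /row_entry /= addn1.
  by rewrite /= ec; apply: peak_comp_nth => //; lia.
- have hb' : (c.+1, r) \in boxes al by rewrite mem_boxes // r0.
  have es : entry al T (c.+1, r) = (entry al T (c, r)).+1.
    by rewrite !entry_row_tableau // /row_entry addnS.
  rewrite -{1}ei (negPf (not_DesT_entry cal row_tableau_perm hb hb' es (ltnSn c))).
  apply/esym/negP; rewrite DesE => /mapP[s _ eis].
  have [sr|rs] := leqP s r.-1; first by have := leq_sumn_take al sr; lia.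
  by have := leq_sumn_take al rs; rewrite sumn_takeS; lia.
Qed.

Lemma Peak_row_tableau : Peak (DesT T) = Des al.
Proof. by rewrite DesT_row_tableau Peak_Des. Qed.

End RowTableau.

(** * The basis theorem *)

Section Span.
Variables (R : realType) (P : pred (seq nat)) (f : seq nat -> powser R).
Implicit Types (s : seq (seq nat)) (a : seq nat -> R[i]) (g h : powser R).

(** The lists in [in_span] may repeat indices; two combinations are added after collecting both over
    a common duplicate-free list. *)
Lemma sum_count_mem (V : nmodType) (I : eqType) (F : I -> V) (s u : seq I) :
    uniq u -> {subset s <= u} ->
  \sum_(i <- s) F i = \sum_(i <- u) F i *+ count_mem i s.
Proof.
move=> uu; elim: s => [|x s IH] su.
  by rewrite big_nil big1.
have xu : x \in u by rewrite su ?mem_head.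
rewrite big_cons IH; last by move=> y ys; rewrite su // inE ys orbT.
rewrite [RHS](eq_bigr (fun i => F i *+ (x == i) + F i *+ count_mem i s)); last first.
  by move=> i _; rewrite -mulrnDr.
rewrite big_split /=; congr (_ + _).
rewrite (bigD1_seq x) //= eqxx big1 ?addr0 // => i.
by rewrite eq_sym => /negPf ->.
Qed.

Lemma in_spanD g h : in_span P f g -> in_span P f h -> in_span P f (g + h).
Proof.
move=> [s [a [Ps ->]]] [s' [a' [Ps' ->]]].
pose u := undup (s ++ s').
exists u, (fun al => a al *+ count_mem al s + a' al *+ count_mem al s'); split.
  by apply/allP => al; rewrite mem_undup mem_cat => /orP[/(allP Ps)|/(allP Ps')].
have su : {subset s <= u} by move=> x xs; rewrite mem_undup mem_cat xs.
have su' : {subset s' <= u} by move=> x xs; rewrite mem_undup mem_cat xs orbT.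
rewrite (sum_count_mem _ (undup_uniq _) su) (sum_count_mem _ (undup_uniq _) su').
by rewrite -big_split; apply: eq_bigr => al _; rewrite scalerDl !scalerMnl.
Qed.

Lemma in_spanZ c g : in_span P f g -> in_span P f (c *: g).
Proof.
move=> [s [a [Ps ->]]]; exists s, (fun al => c * a al); split=> //.
by rewrite scaler_sumr; apply: eq_bigr => al _; rewrite scalerA.
Qed.

Lemma in_span0 : in_span P f 0.
Proof. by exists [::], (fun=> 0); rewrite big_nil. Qed.

Lemma in_span_mem al : P al -> in_span P f (f al).
Proof. by move=> Pal; exists [:: al], (fun=> 1); rewrite big_seq1 scale1r /= Pal. Qed.

Lemma in_span_sum (I : eqType) (r : seq I) (Q : pred I) (F : I -> powser R) :
  (forall i, i \in r -> Q i -> in_span P f (F i)) -> in_span P f (\sum_(i <- r | Q i) F i).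
Proof.
move=> h; rewrite big_seq_cond; elim/big_ind: _ => [||i /andP[]]; last exact: h.
- exact: in_span0.
- exact: in_spanD.
Qed.

Lemma in_span_trans (f' : seq nat -> powser R) g :
  (forall al, P al -> in_span P f (f' al)) -> in_span P f' g -> in_span P f g.
Proof.
move=> h [s [a [/allP Ps ->]]]; apply: in_span_sum => al als _.
exact/in_spanZ/h/Ps.
Qed.

End Span.

(** * The Schur functions as sums of peak functions *)

Section Expansion.
Variables (R : realType) (ch : forall n : nat, smodule R n -> powser R).
Hypothesis hch : is_peak_characteristic ch.

Let chD n (M' M M'' : smodule R n) (f : 'Hom(M', M)) (g : 'Hom(M, M'')) :
  is_short_exact f g -> ch M = ch M' + ch M''.
Proof. by case: hch => _ + _; apply. Qed.

Lemma ch_simple n al (N : hmodule R n) (M : smodule R n) : sumn al = n ->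
    is_comp al -> is_simple_F al N -> is_induced N M ->
  ch M = K_fun R (comp_of n (Peak (Des al))).
Proof. by move=> e; subst n; case: hch => _ _; apply. Qed.

Lemma DesT_range n T : perm_eq T (iota 1 n) -> all (fun i => (0 < i < n)%N) (DesT T).
Proof. by move=> Tp; apply/allP => i; rewrite (mem_DesT _ Tp) => /andP[]. Qed.

Lemma ch_line n T : perm_eq T (iota 1 n) ->
  ch (induced (line_module R n (fun i => i \in DesT T))) =
    K_fun R (comp_of n (Peak (DesT T))).
Proof.
move=> Tp; have sD := DesT_sorted T; have rD := DesT_range Tp.
rewrite (@ch_simple n (comp_of n (DesT T)) (line_module R n (fun i => i \in DesT T))).
- by rewrite Des_comp_of.
- exact: sumn_comp_of.
- exact: comp_of_comp.
- exists (1 : R[i]^o); split=> [|i _]; last by rewrite /= line_hpiE Des_comp_of.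
  have -> : fullv = <[1 : R[i]^o]>%VS; last by apply: seq1_basis; apply: oner_neq0.
  apply/vspaceP => a; rewrite memvf; apply/esym/vlineP.
  by exists a; rewrite /GRing.scale /= mulr1.
- exact: induced_is_induced.
Qed.

Lemma fock_full0 (F : fieldType) (V : vectType F) k :
  fullv = 0%VS :> {vspace V} -> fullv = 0%VS :> {vspace fock V k}.
Proof.
move=> V0; have v0 (v : V) : v = 0 by apply/eqP; rewrite -memv0 -V0 memvf.
apply/vspaceP => u; rewrite memvf memv0; apply/esym/eqP.
elim: k u => [|k IH] u; first exact: v0.
by case: u => x y; rewrite (IH x) (IH y).
Qed.

Lemma ch_diagram n TT (N : hmodule R n) :
    {in TT, forall T, perm_eq T (iota 1 n)} -> is_diagram_module TT N ->
  ch (induced N) = \sum_(T <- TT) K_fun R (comp_of n (Peak (DesT T))).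
Proof.
have [m] := ubnP (size TT); elim: m TT N => // m IH TT N sz TTp dN.
have [TT0|TT0] := eqVneq TT [::].
  case: dN => b [+ _]; rewrite TT0 big_nil => /span_basis; rewrite span_nil => N0.
  by apply: (ch_eq0 (@chD n)); apply: (fock_full0 n (esym N0)).
have [T0 T0TT T0min] := seq_argmin wt TT0.
have [N' [f [g [dN' ex]]]] := diagram_step dN TTp T0TT T0min.
have sz' : (size (rem T0 TT) < m)%N.
  by rewrite size_rem //; move: sz T0TT; case: (TT).
have TTp' : {in rem T0 TT, forall T, perm_eq T (iota 1 n)} by move=> T /mem_rem /TTp.
by rewrite (chD ex) ch_line ?TTp // (IH _ _ sz' TTp' dN') [RHS](big_rem T0) //= addrC.
Qed.

Lemma ch_induced n (N : hmodule R n) (M : smodule R n) :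
  is_induced N M -> ch M = ch (induced N).
Proof.
move=> NM; have [f [fs f0 f1]] := induced_iso (induced_is_induced N) NM.
(* The zero supermodule required by [ch_iso] is induced from the zero submodule of N. *)
have st0 i : (0 < i < n)%N -> (hpi N i @: 0 <= 0)%VS by rewrite limg0.
apply: (ch_iso (@chD n) (Z := induced (submodule st0)) _ fs f0 f1).
apply: fock_full0; apply/vspaceP => v; rewrite memvf memv0; apply/esym/eqP/subvs_inj/eqP.
by rewrite linear0 -memv0 subvsP.
Qed.

Lemma young_schurE al (S : powser R) : is_peak_young_schur ch al S ->
  S = \sum_(T <- SPYCT al) K_fun R (comp_of (sumn al) (Peak (DesT T))).
Proof.
move=> [N [M [dN NM ->]]]; rewrite (ch_induced NM).
apply: ch_diagram dN => T.
by rewrite mem_filter mem_permutations => /andP[].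
Qed.

End Expansion.

(** * Inversion of the triangular expansions *)

Section Triangularity.
Variables (R : realType) (S : seq nat -> powser R).

Definition peakcomp al T : seq nat := comp_of (sumn al) (Peak (DesT T)).

Hypothesis SE : forall al, is_peak_comp al ->
  S al = \sum_(T <- SPYCT al) K_fun R (peakcomp al T).

Definition cmu al : nat := mu (sumn al) (Des al).

Lemma peakcomp_spec al T : is_peak_comp al -> T \in SPYCT al ->
  [/\ is_peak_comp (peakcomp al T), sumn (peakcomp al T) = sumn al &
      (cmu al < cmu (peakcomp al T))%N \/ peakcomp al T = al].
Proof.
move=> pal; rewrite mem_filter mem_permutations => /andP[hT Tp].
have cal : is_comp al by case/andP: pal.
have sD := DesT_sorted T; have rD := DesT_range Tp.
have sP : sorted ltn (Peak (DesT T)) := sorted_filter ltn_trans _ sD.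
have rP : all (fun i => (0 < i < sumn al)%N) (Peak (DesT T)).
  by apply/allP => i; rewrite mem_filter => /andP[_ /(allP rD)].
have es := sumn_comp_of sP rP; have eD := Des_comp_of sP rP.
have pk : is_peak_comp (peakcomp al T) by apply: comp_of_peak => //; apply: Peak_path.
split=> //; rewrite /cmu es eD; have [h|h] := mu_Peak_SPYCT pal hT; [by left|right].
by apply: Des_inj => //; [case/andP: pk|rewrite eD].
Qed.

(** The two triangularities are composed: from S to peak functions, and from these to monomials. *)
Lemma S_monomial al P : is_peak_comp al -> is_peak_comp P -> S al (monomial P) <> 0 ->
  (cmu al < cmu P)%N \/ al = P.
Proof.
move=> pal pP; rewrite SE // fct_sumE => h.
have [T [TT hT]] : exists T, T \in SPYCT al /\ K_fun R (peakcomp al T) (monomial P) <> 0.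
  apply: contrapT => nex; apply: h; rewrite big_seq big1 // => T hT.
  by apply: contrapT => h; apply: nex; exists T.
have [pk es hmu] := peakcomp_spec pal TT.
have [es' hmu'] := K_fun_monomial pk pP hT.
case: hmu' => [hmu'|<-]; last by case: hmu => [|->]; [left|right].
left; rewrite -/(cmu P) -es' -/(cmu (peakcomp al T)) in hmu'.
by case: hmu => [h'|<-//]; apply: ltn_trans hmu'.
Qed.

Lemma SPYCT_count al : is_peak_comp al ->
  (0 < count (fun T => peakcomp al T == al) (SPYCT al))%N.
Proof.
move=> pal; rewrite -has_count; apply/hasP; exists (row_tableau al).
  exact: row_tableau_SPYCT.
rewrite /peakcomp Peak_row_tableau //; apply/eqP/comp_of_Des.
by case/andP: pal.
Qed.

Lemma S_expansion al : is_peak_comp al ->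
  S al = K_fun R al *+ count (fun T => peakcomp al T == al) (SPYCT al)
       + \sum_(T <- SPYCT al | peakcomp al T != al) K_fun R (peakcomp al T).
Proof.
move=> pal; rewrite SE // (bigID (fun T => peakcomp al T == al)) /=; congr (_ + _).
rewrite (eq_bigr (fun=> K_fun R al)) ?big_const_seq ?iter_addr_0 //.
by move=> T /eqP ->.
Qed.

Lemma S_monomial_diag al : is_peak_comp al -> S al (monomial al) <> 0.
Proof.
move=> pal; rewrite S_expansion // addrfctE natmulfctE fct_sumE big_seq_cond big1 ?addr0.
  apply/eqP; rewrite mulrn_eq0 negb_or -lt0n SPYCT_count //.
  exact/eqP/K_fun_monomial_diag.
(* An off-diagonal term has an index of larger weight than [al], whereas a peak function containing
   this monomial has an index of weight at most that of [al]. *)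
move=> T /andP[TT /eqP ne]; apply: contrapT => h.
have [pk es hmu] := peakcomp_spec pal TT.
have [es' hmu'] := K_fun_monomial pk pal h.
case: hmu' => //; case: hmu => // lt.
rewrite -[X in mu X (Des (peakcomp _ _))]es -/(cmu _) -/(cmu _).
by rewrite ltnNge ltnW.
Qed.

Lemma S_lin_indep : lin_indep is_peak_comp S.
Proof.
move=> s a us /allP ps sum0.
(* By induction on the weight of P, compare coefficients of its monomial: lighter indices have
   coefficient zero already, and the other indices different from P do not contribute. *)
suff h m : forall al, al \in s -> (cmu al < m)%N -> a al = 0.
  by move=> al als; apply: (h (cmu al).+1).
elim: m => // m IH P Ps; rewrite ltnS => Pm.
have := congr1 (fun g : powser R => g (monomial P)) sum0.
rewrite /= fct_sumE (bigD1_seq P) //= big_seq_cond big1 ?addr0.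
  rewrite scalrfctE => /eqP; rewrite mulf_eq0 => /orP[/eqP//|/eqP].
  by move/S_monomial_diag => /(_ (ps _ Ps)).
move=> al /andP[als ne]; rewrite scalrfctE; apply/eqP; rewrite mulf_eq0.
case: (eqVneq (S al (monomial P)) 0) => [_|/eqP h]; first by rewrite orbT.
have [lt|e] := S_monomial (ps _ als) (ps _ Ps) h; last by rewrite e eqxx in ne.
by rewrite IH ?eqxx // (leq_trans lt).
Qed.

(** The weight grows along the expansion of S, so an upper bound depending on the degree alone lets
    the next induction end. *)
Lemma cmu_bound al : is_comp al -> (cmu al <= sumn al * sumn al)%N.
Proof.
move=> cal; apply: (@leq_trans (\sum_(p <- Des al) sumn al)).
  by apply: leq_sum => p _; apply: leq_subr.
rewrite big_const_seq iter_addn_0 count_predT leq_mul2l DesE size_map size_iota.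
apply/orP; right; apply: leq_trans (leq_pred _) _.
by elim: (al) cal => //= x s IH /andP[x0 /IH]; lia.
Qed.

(** The expansion is solved for K_al, dividing by its positive multiplicity; all other peak
    functions in it have larger weight and the same degree. *)
Lemma K_in_span_S al : is_peak_comp al -> in_span is_peak_comp S (K_fun R al).
Proof.
have [m] := ubnP (sumn al * sumn al - cmu al); elim: m al => // m IH al hm pal.
set c := count (fun T => peakcomp al T == al) (SPYCT al).
have -> : K_fun R al = c%:R^-1 *: (S al +
    (-1) *: \sum_(T <- SPYCT al | peakcomp al T != al) K_fun R (peakcomp al T)).
  rewrite S_expansion // scaleN1r addrK -[_ *+ count _ _]scaler_nat scalerK //.
  by rewrite pnatr_eq0 -lt0n SPYCT_count.
apply/in_spanZ/in_spanD; first exact: in_span_mem.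
apply/in_spanZ/in_span_sum => T TT /eqP ne.
have [pk es [lt|//]] := peakcomp_spec pal TT.
apply: IH => //; have := cmu_bound (_ : is_comp (peakcomp al T)); rewrite es.
by case/andP: (pk) => -> _ /(_ isT); lia.
Qed.

Lemma S_in_span_K al : is_peak_comp al -> in_span is_peak_comp (@K_fun R) (S al).
Proof.
move=> pal; rewrite SE //; apply: in_span_sum => T TT _.
by apply: in_span_mem; have [] := peakcomp_spec pal TT.
Qed.

End Triangularity.

Theorem theorem5p11 (R : realType)
    (ch : forall n : nat, smodule R n -> powser R)
    (hch : is_peak_characteristic ch)
    (S : seq nat -> powser R)
    (hS : forall al : seq nat, is_peak_comp al ->
      is_peak_young_schur ch al (S al)) :
  is_basis is_peak_comp S (@peak_algebra R).
Proof.
have SE al : is_peak_comp al ->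
    S al = \sum_(T <- SPYCT al) K_fun R (peakcomp al T).
  by move=> pal; apply: young_schurE hch _ _ (hS al pal).
split; first exact: S_lin_indep SE.
move=> g; split; apply: in_span_trans => al; first exact: K_in_span_S.
exact: S_in_span_K.
Qed.
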